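(* Let $c>0$. The initial-boundary-value problem for the wave equation $\partial_t^2u=c^2\Delta u$ on a rectangle $[0,L_x]\times[0,L_y]$, discretized to orders $2p=2,4,6$ with the compact modified-equation (ME) time-stepping scheme and the LCBC method on a Cartesian grid with spacings $\Delta x,\Delta y$ and time step $\Delta t$, with Dirichlet or Neumann boundary conditions (all defined in the context), is stable under the time-step restriction $$c^2\Delta t^2\Big(\frac1{\Delta x^2}+\frac1{\Delta y^2}\Big)<1.$$
   Context: Grid: $\mathbf x_{i,j}=(i\Delta x,j\Delta y)$, $\Delta x=L_x/N_x$, $\Delta y=L_y/N_y$, $0\le i\le N_x$, $0\le j\le N_y$, extended by $p$ ghost lines outside each face; $U^n_{i,j}\approx u(\mathbf x_{i,j},n\Delta t)$. Each face carries a Dirichlet or a Neumann boundary condition. Stability concerns the homogeneous problem (zero forcing, zero boundary data). Compact ME scheme. Let $X=D_{+x}D_{-x}$ and $Y=D_{+y}D_{-y}$ be the standard second divided differences, $XU_{i,j}=(U_{i+1,j}-2U_{i,j}+U_{i-1,j})/\Delta x^2$ and similarly $Y$, and $\Delta_{2,h}=X+Y$, $\Delta_{4,h}=X(I-\tfrac{\Delta x^2}{12}X)+Y(I-\tfrac{\Delta y^2}{12}Y)$, $\Delta_{6,h}=X(I-\tfrac{\Delta x^2}{12}X+\tfrac{\Delta x^4}{90}X^2)+Y(I-\tfrac{\Delta y^2}{12}Y+\tfrac{\Delta y^4}{90}Y^2)$, $B_{4,h}=X^2(I-\tfrac{\Delta x^2}{6}X)+Y^2(I-\tfrac{\Delta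 y^2}{6}Y)+2X(I-\tfrac{\Delta x^2}{12}X)\,Y(I-\tfrac{\Delta y^2}{12}Y)$ (a fourth-order accurate approximation of $\Delta^2$ with stencil width $7$, used in place of $\Delta_{4,h}^2$). The scheme is $$\frac{U^{n+1}-2U^n+U^{n-1}}{\Delta t^2}=\begin{cases}c^2\Delta_{2,h}U^n,&p=1,\\ c^2\Delta_{4,h}U^n+\frac{\Delta t^2}{12}c^4\Delta_{2,h}^2U^n,&p=2,\\ c^2\Delta_{6,h}U^n+\frac{\Delta t^2}{12}c^4B_{4,h}U^n+\frac{\Delta t^4}{360}c^6\Delta_{2,h}^3U^n,&p=3,\end{cases}$$ applied at interior grid points and at grid points on Neumann faces; $U^n=0$ at grid points on Dirichlet faces. LCBC ghost values (LCBC = Local Compatibility Boundary Condition), with $Q=c^2\Delta$. Let $V_p$ be the polynomials in $(x,y)$ of degree at most $2p$ in each variable. Faces: at a left-face point $(0,\tilde y)=\mathbf x_{0,\tilde j}$, $p\le\tilde j\le N_y-p$, let $\tilde u\in V_p$ satisfy $\tilde u(\hat i\Delta x,\tilde y+\hat j\Delta y)=U_{\hat i,\tilde j+\hat j}$ for $\hat i=0,\dots,p$, $\hat j=-p,\dots,p$, together with: (Dirichlet) $\partial_y^\mu Q^\nu\tilde u(0,\tilde y)=0$, $\nu=1,\dots,p$, $\mu=0,\dots,2p$; or (Neumann) $\partial_y^\mu\partial_xQ^\nu\tilde u(0,\tilde y)=0$, $\nu=0,\dots,p-1$, $\mu=0,\dots,2p$. Set $U_{-\hat i,\tilde j}=\tilde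 u(-\hat i\Delta x,\tilde y)$, $\hat i=1,\dots,p$. Other faces are treated similarly. Corners (written for the bottom-left corner $(0,0)$, and for Dirichlet on $x=0$, Neumann on $y=0$ in the mixed case; other corners are treated similarly). Let $\tilde u\in V_p$ satisfy the constraints below, where averaging two conditions $\ell_1(\tilde u)=0$ (from face $x=0$) and $\ell_2(\tilde u)=0$ (from face $y=0$) with weights $w_1,w_2$ means replacing them by $w_1\ell_1(\tilde u)+w_2\ell_2(\tilde u)=0$. - Dirichlet-Dirichlet: $\tilde u(\hat i\Delta x,\hat j\Delta y)=U_{\hat i,\hat j}$, $\hat i,\hat j=1,\dots,p$; and for $\nu=0,\dots,p$, $\mu\in\{1,3,\dots,2\nu-1\}\cup\{2\nu,\dots,2p\}$: $\partial_y^\mu Q^\nu\tilde u(0,0)=0$, $\partial_x^\mu Q^\nu\tilde u(0,0)=0$, the pair with $\mu=2\nu$ averaged with weights $\Delta y^\mu,\Delta x^\mu$. - Neumann-Neumann: $\tilde u(\hat i\Delta x,\hat j\Delta y)=U_{\hat i,\hat j}$, $\hat i,\hat j=0,\dots,p$; and for $\nu=0,\dots,p-1$, $\mu\in\{0,2,\dots,2\nu\}\cup\{2\nu+1,\dots,2p\}$: $\partial_y^\mu\partial_xQ^\nu\tilde u(0,0)=0$, $\partial_x^\mu\partial_yQ^\nu\tilde u(0,0)=0$, the pair with $\mu=2\nu+1$ averaged with weights $\Delta y^\mu,\Delta x^\mu$. - Dirichlet-Neumann: $\tilde u(\hat i\Delta x,\hat j\Delta y)=U_{\hat i,\hat j}$,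 $\hat i=1,\dots,p$, $\hat j=0,\dots,p$; for $\nu=0,\dots,p-1$: $\partial_y^{\mu_1}Q^\nu\tilde u(0,0)=0$ for $\mu_1\in\{0,2,\dots,2\nu\}\cup\{2\nu+1,\dots,2p\}$ and $\partial_x^{\mu_2}\partial_yQ^\nu\tilde u(0,0)=0$ for $\mu_2\in\{1,3,\dots,2\nu-1\}\cup\{2\nu,\dots,2p\}$, the conditions $\mu_1=2\nu+1$, $\mu_2=2\nu$ averaged with weights $\Delta y^{2\nu},\Delta x^{2\nu}$; and $\partial_y^{\mu_1}Q^p\tilde u(0,0)=0$ for $\mu_1\in\{0,2,\dots,2p\}$. Set $U_{\hat i,\hat j}=\tilde u(\hat i\Delta x,\hat j\Delta y)$ for all ghost indices $-p\le\hat i,\hat j\le p-1$ with $\hat i<0$ or $\hat j<0$. Stability. Normal-mode solutions $U^n_{i,j}=A^n\varphi_{i,j}$ of the homogeneous scheme, with $\varphi$ satisfying the discrete boundary conditions, have amplification factors $A$ satisfying a quadratic $A^2-2bA+1=0$, with $b$ depending on the mode and the discretization parameters. The scheme is stable if for all modes $|A|\le1$ and double roots $b=\pm1$ (which lead to algebraic growth) are excluded, that is, $b$ is real and $|b|<1$.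
   Formalization: With Neumann conditions on all four faces the constant grid function is a mode with A = 1, b = 1 for any time step, so |b| < 1 fails; the formal statement proves |b| < 1 for all modes except this one, for which it asserts b = 1. *)

(* Defs.v *)
From HB Require Import structures.
From mathcomp Require Import all_boot all_order all_algebra.
From mathcomp Require Import polyXY complex.
From mathcomp Require Import reals.

Set Implicit Arguments.
Unset Strict Implicit.
Unset Printing Implicit Defensive.

Import Order.TTheory GRing.Theory Num.Theory.
Local Open Scope ring_scope.
Local Open Scope complex_scope.

Inductive bctype := Dirichlet | Neumann.

Record boundary := Boundary {
  bc_left : bctype; bc_right : bctype; bc_bottom : bctype; bc_top : bctype }.

Definition is_dirichlet (b : bctype) : bool :=
  if b is Dirichlet then true else false.

(* Everything but stability is stated over an arbitrary field [K]; the real    *)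
(* discretization parameters are embedded in [K := R[i]] because normal modes  *)
(* are complex.                                                                *)

(* A grid function is total on Z^2; only its values at the indices             *)
(* -p <= i <= Nx + p, -p <= j <= Ny + p are ever used.                         *)
Definition grid (K : Type) := int -> int -> K.

Definition transpose (K : Type) (U : grid K) : grid K := fun i j => U j i.

Section Scheme.
Variable K : fieldType.
Variables c dx dy dt : K.
Implicit Type U : grid K.

Definition Xdiff U : grid K := fun i j =>
  (U (i + 1) j - 2 * U i j + U (i - 1) j) / dx ^+ 2.

Definition Ydiff U : grid K := fun i j =>
  (U i (j + 1) - 2 * U i j + U i (j - 1)) / dy ^+ 2.

Definition lap2 U : grid K := fun i j => Xdiff U i j + Ydiff U i j.

(* X (I - dx^2/12 X) and Y (I - dy^2/12 Y) *)
Definition Xdiff4 U : grid K :=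
  Xdiff (fun i j => U i j - dx ^+ 2 / 12 * Xdiff U i j).
Definition Ydiff4 U : grid K :=
  Ydiff (fun i j => U i j - dy ^+ 2 / 12 * Ydiff U i j).

Definition lap4 U : grid K := fun i j => Xdiff4 U i j + Ydiff4 U i j.

Definition Xdiff6 U : grid K :=
  Xdiff (fun i j => U i j - dx ^+ 2 / 12 * Xdiff U i j
                          + dx ^+ 4 / 90 * Xdiff (Xdiff U) i j).
Definition Ydiff6 U : grid K :=
  Ydiff (fun i j => U i j - dy ^+ 2 / 12 * Ydiff U i j
                          + dy ^+ 4 / 90 * Ydiff (Ydiff U) i j).

Definition lap6 U : grid K := fun i j => Xdiff6 U i j + Ydiff6 U i j.

Definition bilap4 U : grid K := fun i j =>
  Xdiff (Xdiff (fun k l => U k l - dx ^+ 2 / 6 * Xdiff U k l)) i j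
  + Ydiff (Ydiff (fun k l => U k l - dy ^+ 2 / 6 * Ydiff U k l)) i j
  + 2 * Xdiff4 (Ydiff4 U) i j.

(* The orders of accuracy are 2p = 2, 4, 6; other values of p are junk. *)
Definition me_rhs (p : nat) U : grid K := fun i j =>
  match p with
  | 1%N => c ^+ 2 * lap2 U i j
  | 2%N => c ^+ 2 * lap4 U i j + dt ^+ 2 / 12 * c ^+ 4 * lap2 (lap2 U) i j
  | 3%N => c ^+ 2 * lap6 U i j + dt ^+ 2 / 12 * c ^+ 4 * bilap4 U i j
         + dt ^+ 4 / 360 * c ^+ 6 * lap2 (lap2 (lap2 U)) i j
  | _ => 0
  end.

End Scheme.

Section LCBC.
Variable K : fieldType.
Variables (p : nat) (c : K).

(* In [u : {poly {poly K}}] the outer variable is x, the inner one is y, and   *)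
(* [u.[x, y]] evaluates accordingly.                                           *)
Implicit Type u : {poly {poly K}}.

Definition in_V u : Prop :=
  (size u <= (2 * p).+1)%N /\ (sizeY u <= (2 * p).+1)%N.

Definition Dx u : {poly {poly K}} := u^`().
Definition Dy u : {poly {poly K}} := map_poly (@deriv K) u.
Definition Qop u : {poly {poly K}} :=
  (c ^+ 2)%:P *: (Dx (Dx u) + Dy (Dy u)).

Section Patch.
Variables hx hy : K.

Definition evalg u (i j : int) : K := u.[i%:~R * hx, j%:~R * hy].

(* Left (i0 = 0, s = 1) or right (i0 = Nx, s = -1) face; [s] is the inward     *)
(* direction and N the number of cells along the face. The bottom and top      *)
(* faces are obtained by exchanging the two coordinates.                       *)
Definition lcbc_face (b : bctype) (N : nat) (i0 s : int) (U : grid K) : Prop :=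
  forall jt : nat, (p <= jt)%N -> (jt + p <= N)%N ->
  exists u, [/\ in_V u,
    (forall (i : nat) (j : int), (i <= p)%N -> `|j| <= p%:Z ->
       evalg u (i0 + s * i%:Z) (jt%:Z + j) = U (i0 + s * i%:Z) (jt%:Z + j)),
    match b with
    | Dirichlet => forall nu mu : nat, (1 <= nu <= p)%N -> (mu <= 2 * p)%N ->
        evalg (iter mu Dy (iter nu Qop u)) i0 jt%:Z = 0
    | Neumann => forall nu mu : nat, (nu < p)%N -> (mu <= 2 * p)%N ->
        evalg (iter mu Dy (Dx (iter nu Qop u))) i0 jt%:Z = 0
    end
  & forall i : nat, (1 <= i <= p)%N ->
      U (i0 - s * i%:Z) jt%:Z = evalg u (i0 - s * i%:Z) jt%:Z].

Definition corner_DD u (i0 j0 : int) : Prop :=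
  forall nu mu : nat, (nu <= p)%N ->
    ((odd mu && (mu < 2 * nu)) || (2 * nu <= mu <= 2 * p))%N ->
  let l1 := evalg (iter mu Dy (iter nu Qop u)) i0 j0 in
  let l2 := evalg (iter mu Dx (iter nu Qop u)) i0 j0 in
  if mu == (2 * nu)%N then hy ^+ mu * l1 + hx ^+ mu * l2 = 0
  else l1 = 0 /\ l2 = 0.

Definition corner_NN u (i0 j0 : int) : Prop :=
  forall nu mu : nat, (nu < p)%N ->
    ((~~ odd mu && (mu <= 2 * nu)) || (2 * nu + 1 <= mu <= 2 * p))%N ->
  let l1 := evalg (iter mu Dy (Dx (iter nu Qop u))) i0 j0 in
  let l2 := evalg (iter mu Dx (Dy (iter nu Qop u))) i0 j0 in
  if mu == (2 * nu + 1)%N then hy ^+ mu * l1 + hx ^+ mu * l2 = 0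
  else l1 = 0 /\ l2 = 0.

(* Dirichlet on the face x = const, Neumann on the face y = const. *)
Definition corner_DN u (i0 j0 : int) : Prop :=
  let l1 mu nu := evalg (iter mu Dy (iter nu Qop u)) i0 j0 in
  let l2 mu nu := evalg (iter mu Dx (Dy (iter nu Qop u))) i0 j0 in
  (forall nu : nat, (nu < p)%N ->
    [/\ forall mu : nat,
          ((~~ odd mu && (mu <= 2 * nu)) || (2 * nu + 1 <= mu <= 2 * p))%N ->
          mu != (2 * nu + 1)%N -> l1 mu nu = 0,
        forall mu : nat,
          ((odd mu && (mu < 2 * nu)) || (2 * nu <= mu <= 2 * p))%N ->
          mu != (2 * nu)%N -> l2 mu nu = 0
      & hy ^+ (2 * nu) * l1 (2 * nu + 1)%N nu
        + hx ^+ (2 * nu) * l2 (2 * nu)%N nu = 0]) /\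
  (forall mu : nat, ~~ odd mu -> (mu <= 2 * p)%N -> l1 mu p = 0).

(* First interpolated index in the direction normal to a face. *)
Definition first_index (b : bctype) : nat := if b is Dirichlet then 1%N else 0%N.

(* Corner at the grid point (i0, j0), with inward directions s and t in x and  *)
(* y; [conds] are the compatibility conditions at that point.                  *)
Definition lcbc_corner_with (conds : {poly {poly K}} -> int -> int -> Prop)
    (bx by_ : bctype) (i0 s j0 t : int) (U : grid K) : Prop :=
  exists u, [/\ in_V u,
    (forall i j : nat, (first_index bx <= i <= p)%N ->
       (first_index by_ <= j <= p)%N ->
       evalg u (i0 + s * i%:Z) (j0 + t * j%:Z)
         = U (i0 + s * i%:Z) (j0 + t * j%:Z)),
    conds u i0 j0
  & forall i j : int, - p%:Z <= i <= p%:Z - 1 -> - p%:Z <= j <= p%:Z - 1 ->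
      (i < 0) || (j < 0) ->
      U (i0 + s * i) (j0 + t * j) = evalg u (i0 + s * i) (j0 + t * j)].

End Patch.

Definition lcbc_corner (hx hy : K) (bx by_ : bctype) (i0 s j0 t : int)
    (U : grid K) : Prop :=
  match bx, by_ with
  | Dirichlet, Dirichlet =>
      lcbc_corner_with hx hy (corner_DD hx hy) bx by_ i0 s j0 t U
  | Neumann, Neumann =>
      lcbc_corner_with hx hy (corner_NN hx hy) bx by_ i0 s j0 t U
  | Dirichlet, Neumann =>
      lcbc_corner_with hx hy (corner_DN hx hy) bx by_ i0 s j0 t U
  | Neumann, Dirichlet =>
      lcbc_corner_with hy hx (corner_DN hy hx) by_ bx j0 t i0 s (transpose U)
  end.

End LCBC.

Section Modes.
Variable K : fieldType.
Variables (p : nat) (bcs : boundary) (c dx dy dt : K) (Nx Ny : nat).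

Definition on_grid (i j : int) : bool :=
  (0 <= i <= Nx%:Z) && (0 <= j <= Ny%:Z).

Definition on_dirichlet (i j : int) : bool :=
  on_grid i j &&
  [|| (i == 0) && is_dirichlet (bc_left bcs),
      (i == Nx%:Z) && is_dirichlet (bc_right bcs),
      (j == 0) && is_dirichlet (bc_bottom bcs)
    | (j == Ny%:Z) && is_dirichlet (bc_top bcs)].

Definition discrete_bc (U : grid K) : Prop :=
  [/\ forall i j, on_dirichlet i j -> U i j = 0,
      [/\ lcbc_face p c dx dy (bc_left bcs) Ny 0 1 U,
          lcbc_face p c dx dy (bc_right bcs) Ny Nx%:Z (-1) U,
          lcbc_face p c dy dx (bc_bottom bcs) Nx 0 1 (transpose U)
        & lcbc_face p c dy dx (bc_top bcs) Nx Ny%:Z (-1) (transpose U)]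
    & [/\ lcbc_corner p c dx dy (bc_left bcs) (bc_bottom bcs)
            0 1 0 1 U,
          lcbc_corner p c dx dy (bc_right bcs) (bc_bottom bcs)
            Nx%:Z (-1) 0 1 U,
          lcbc_corner p c dx dy (bc_left bcs) (bc_top bcs)
            0 1 Ny%:Z (-1) U
        & lcbc_corner p c dx dy (bc_right bcs) (bc_top bcs)
            Nx%:Z (-1) Ny%:Z (-1) U]].

(* A grid point where a Dirichlet and a Neumann face meet is a Dirichlet       *)
(* point: the update is not applied there.                                     *)
Definition me_scheme (U : nat -> grid K) : Prop :=
  forall (n : nat) (i j : int), on_grid i j -> ~~ on_dirichlet i j ->
  (U n.+2 i j - 2 * U n.+1 i j + U n i j) / dt ^+ 2
    = me_rhs c dx dy dt p (U n.+1) i j.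

(* [phi] is required to be nonzero on the grid itself. *)
Definition normal_mode (A : K) (phi : grid K) : Prop :=
  [/\ exists i j, on_grid i j /\ phi i j != 0,
      discrete_bc phi
    & me_scheme (fun n i j => A ^+ n * phi i j)].

(* With Neumann conditions on all four faces the constant grid functions are   *)
(* modes; they correspond to the solutions u = a + b t of the wave equation.   *)
Definition neutral_mode (phi : grid K) : Prop :=
  [/\ [/\ bc_left bcs = Neumann, bc_right bcs = Neumann,
          bc_bottom bcs = Neumann & bc_top bcs = Neumann]
    & exists a : K, forall i j, on_grid i j -> phi i j = a].

End Modes.

(* A normal mode has A != 0 (use the update with n = 0), so that b is          *)
(* determined by A. The value b = 1 is unavoidable for the constant mode of    *)
(* the all-Neumann problem, where the exact solution grows linearly as well;   *)
(* it is the only exception to |b| < 1.                                        *)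
Definition stable (R : realType) (p : nat) (bcs : boundary)
    (c dx dy dt : R) (Nx Ny : nat) : Prop :=
  forall (A : R[i]) (phi : grid R[i]),
  normal_mode p bcs c%:C dx%:C dy%:C dt%:C Nx Ny A phi ->
  exists b : R, A ^+ 2 - 2 * b%:C * A + 1 = 0 /\
    (`|b| < 1 \/ neutral_mode bcs Nx Ny phi /\ b = 1).

(* Main.v *)
Require Import Defs.
From mathcomp Require Import all_boot all_order all_algebra.
From mathcomp Require Import reals.
From mathcomp Require Import polyXY complex separable cyclotomic ring lra zify.
From mathcomp Require boolp.

Set Implicit Arguments.
Unset Strict Implicit.
Unset Printing Implicit Defensive.

Import Order.TTheory GRing.Theory Num.Theory.
Local Open Scope ring_scope.

(** The LCBC conditions determine all Taylor coefficients of the interpolating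
    polynomial at the boundary point except those of one parity in the normal
    direction(s), so the interpolant is odd across a Dirichlet face and even
    across a Neumann face: the ghost values are reflections.  A normal mode
    therefore extends by reflection to a doubly periodic eigenfunction of the
    translation invariant operator of the scheme on Z^2.  Its discrete Fourier
    transform is nonzero at some pair (z, w) of roots of unity, and with
    x = 2 - 2 Re z, y = 2 - 2 Re w in [0, 4] this forces
    A^2 - 2 A + 1 = - g(x, y) A for an explicit polynomial g.  Under the CFL
    condition g is strictly increasing in x and in y, with g(0, 0) = 0 and
    g(4, 4) < 4; since b = 1 - g / 2, we get |b| < 1 unless x = y = 0 for every
    Fourier mode that occurs, i.e., unless the grid function is constant. *)

(** * Taylor coefficients of the interpolants *)

Section TaylorCoefficients.
Variable K : numFieldType.
Implicit Types (u w : {poly {poly K}}) (x y a b c : K).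

Lemma DxDy u : Dx (Dy u) = Dy (Dx u).
Proof. by apply/polyP=> i; rewrite !(coef_deriv, coef_map) /= derivMn. Qed.

Lemma iter_DxDy k u : iter k (@Dx K) (Dy u) = Dy (iter k (@Dx K) u).
Proof. by elim: k => //= k ->; rewrite DxDy. Qed.

Lemma coef_iterDy l u i : (iter l (@Dy K) u)`_i = (u`_i)^`(l).
Proof. by elim: l => [|l IH] //=; rewrite coef_map /= IH. Qed.

Lemma horner_iterDy l u x : (iter l (@Dy K) u).[x%:P] = (u.[x%:P])^`(l).
Proof.
rewrite (@horner_coef_wide _ (size u)) ?horner_coef ?raddf_sum /=; last first.
  by apply/leq_sizeP => i hi; rewrite coef_iterDy nth_default // linear0.
apply: eq_bigr => i _; rewrite coef_iterDy -polyC_exp.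
by rewrite ![_ * (_ ^+ _)%:P]mulrC !mul_polyC derivnZ.
Qed.

(** Derivatives are not divided by factorials, so that [Qop] acts as [c ^+ 2] times a sum of two
    index shifts. *)
Definition taylor u x y (k l : nat) : K :=
  (iter l (@Dy K) (iter k (@Dx K) u)).[x, y].

Lemma taylor_Dx u x y k l : taylor (Dx u) x y k l = taylor u x y k.+1 l.
Proof. by rewrite /taylor -iterSr. Qed.

Lemma taylor_Dy u x y k l : taylor (Dy u) x y k l = taylor u x y k l.+1.
Proof. by rewrite /taylor iter_DxDy -iterSr. Qed.

Lemma taylorD u w x y k l :
  taylor (u + w) x y k l = taylor u x y k l + taylor w x y k l.
Proof.
rewrite /taylor.
have ->: iter k (@Dx K) (u + w) = iter k (@Dx K) u + iter k (@Dx K) w.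
  exact: derivnD.
by rewrite !horner_iterDy hornerD derivnD hornerD.
Qed.

Lemma taylorZ a u x y k l : taylor (a%:P *: u) x y k l = a * taylor u x y k l.
Proof.
rewrite /taylor.
have ->: iter k (@Dx K) (a%:P *: u) = a%:P *: iter k (@Dx K) u.
  exact: derivnZ.
by rewrite !horner_iterDy hornerZ mul_polyC derivnZ hornerZ.
Qed.

Lemma taylor_Qop c u x y k l : taylor (Qop c u) x y k l =
  c ^+ 2 * (taylor u x y k.+2 l + taylor u x y k l.+2).
Proof. by rewrite /Qop taylorZ taylorD !(taylor_Dx, taylor_Dy). Qed.

Lemma taylor_high p u x y k l : in_V p u -> (2 * p < k)%N || (2 * p < l)%N ->
  taylor u x y k l = 0.
Proof.
case=> [hx hy]; rewrite /taylor; case: ltnP => [hk _|_ /= hl].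
  have ->: iter k (@Dx K) u = 0.
    by apply: derivn_poly0; apply: leq_trans hk.
  by rewrite horner_iterDy horner0 linear0 horner0.
rewrite (_ : iter l _ _ = 0) ?horner0 //.
apply/polyP=> i; rewrite coef_iterDy coef0 -/(derivn k u) coef_derivn.
rewrite derivnMn derivn_poly0 ?mul0rn //.
by apply: leq_trans hl; apply: leq_trans hy; apply: max_size_coefXY.
Qed.

(** The coefficients [e] are the derivatives divided by factorials; parity arguments need only their
    vanishing, so they stay abstract. Taking [m] as a maximum over [k] makes the double sum
    rectangular. *)
Lemma taylor_exp u x y : exists n m, exists e : nat -> nat -> K,
  (forall k l, taylor u x y k l = 0 -> e k l = 0) /\
  forall a b, u.[x + a, y + b] =
    \sum_(k < n) \sum_(l < m) e k l * b ^+ l * a ^+ k.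
Proof.
exists (size u), (\max_(k < size u) size (u^`N(k)).[x%:P])%N.
exists (fun k l => ((u^`N(k)).[x%:P])^`N(l).[y]); split=> [k l|a b].
  rewrite /taylor horner_iterDy -/(derivn k u) [derivn k u]nderivn_def hornerMn.
  rewrite derivnMn nderivn_def !hornerMn -mulrnA => /eqP.
  by rewrite mulrn_eq0 muln_eq0 (gtn_eqF (fact_gt0 k)) (gtn_eqF (fact_gt0 l)) => /eqP.
rewrite polyCD [u.[_ + _]]nderiv_taylor; last exact: mulrC.
rewrite horner_sum; apply: eq_bigr => k _.
rewrite -polyC_exp hornerM hornerC.
rewrite (@nderiv_taylor_wide _ (\max_(k < size u) size (u^`N(k)).[x%:P])).
- by rewrite mulr_suml.
- exact: mulrC.
- by rewrite (leq_bigmax k).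
Qed.

(** Only powers [a ^+ k] with [odd k = o] survive in the expansion. *)
Lemma taylor_parityx (o : bool) u x y :
  (forall k l, odd k != o -> taylor u x y k l = 0) ->
  forall a b, u.[x - a, y + b] = (-1) ^+ o * u.[x + a, y + b].
Proof.
move=> h a b; have [n [m [e [e0 eE]]]] := taylor_exp u x y.
rewrite !eE mulr_sumr; apply: eq_bigr => k _.
rewrite mulr_sumr; apply: eq_bigr => l _.
have [ko|/h/e0->] := eqVneq (odd k) o; last by rewrite !mul0r mulr0.
by rewrite [(- a) ^+ k]exprNn -[(-1) ^+ k]signr_odd ko; ring.
Qed.

Lemma taylor_parityy (o : bool) u x y :
  (forall k l, odd l != o -> taylor u x y k l = 0) ->
  forall a b, u.[x + a, y - b] = (-1) ^+ o * u.[x + a, y + b].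
Proof.
move=> h a b; have [n [m [e [e0 eE]]]] := taylor_exp u x y.
rewrite !eE mulr_sumr; apply: eq_bigr => k _.
rewrite mulr_sumr; apply: eq_bigr => l _.
have [ko|/h/e0->] := eqVneq (odd l) o; last by rewrite !mul0r mulr0.
by rewrite [(- b) ^+ l]exprNn -[(-1) ^+ l]signr_odd ko; ring.
Qed.

End TaylorCoefficients.

(* [f k m nu] stands for d_x^(2k+o) d_y^(2m+o') Q^nu u at a boundary point, with *)
(* fixed parities o, o'.  Working with all powers of Q avoids the binomial       *)
(* expansion of Q^nu.                                                            *)
Section Triangular.
Variable K : fieldType.
Variables (c : K) (f : nat -> nat -> nat -> K).
Hypothesis c0 : c != 0.
Hypothesis fS : forall k m nu,
  f k m nu.+1 = c ^+ 2 * (f k.+1 m nu + f k m.+1 nu).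

Let c20 : c ^+ 2 != 0. Proof. by rewrite expf_neq0. Qed.

Lemma recx0 k m nu : f k m nu.+1 = 0 -> f k m.+1 nu = 0 -> f k.+1 m nu = 0.
Proof.
by move=> + h; rewrite fS h addr0 => /eqP; rewrite mulf_eq0 (negPf c20) => /eqP.
Qed.

(** Solving [fS] for [f k.+1 m nu] trades one step in [k] for at most one more power of Q, so
    [k + nu] does not grow and the rows [nu <= P] suffice. *)
Lemma rec_row P : (forall nu m, (nu <= P)%N -> f 0%N m nu = 0) ->
  forall k m nu, (k + nu <= P)%N -> f k m nu = 0.
Proof.
move=> h; elim=> [|k IH] m nu hk; first exact: h.
by apply: recx0; apply: IH; lia.
Qed.

Lemma rec_tri : (forall nu m, (nu < m)%N -> f 0%N m nu = 0) ->
  forall k m nu, (k + nu < m)%N -> f k m nu = 0.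
Proof.
move=> h; elim=> [|k IH] m nu hk; first exact: h.
by apply: recx0; apply: IH; lia.
Qed.

(** At each step along the diagonal the neighbour [f k m.+1 nu] in [fS] lies in the zero region of
    [rec_tri], so only the factor [c ^+ 2] is left. *)
Lemma rec_diag : (forall nu m, (nu < m)%N -> f 0%N m nu = 0) ->
  forall k nu, f 0%N (nu + k)%N (nu + k)%N = c ^+ (2 * k) * f k (nu + k)%N nu.
Proof.
move=> h; elim=> [|k IH] nu; first by rewrite mul1r addn0.
rewrite -addSnnS IH fS [f k _.+1 _](rec_tri h) ?addr0; last lia.
by rewrite mulrA -exprD mulnS addnC.
Qed.

End Triangular.

(* For [k < m] and [k > m] the conditions of one face suffice; on the diagonal   *)
(* both faces give multiples of the same coefficient, which is why the two       *)
(* conditions can only be imposed in averaged form.                              *)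
Lemma rec_square (K : fieldType) (c : K) (f : nat -> nat -> nat -> K)
    (w1 w2 : nat -> K) (P : nat) :
  c != 0 ->
  (forall k m nu, f k m nu.+1 = c ^+ 2 * (f k.+1 m nu + f k m.+1 nu)) ->
  (forall nu m, (nu < m)%N -> f 0%N m nu = 0) ->
  (forall nu m, (nu < m)%N -> f m 0%N nu = 0) ->
  (forall nu, (nu < P)%N -> w1 nu + w2 nu != 0) ->
  (forall nu, (nu < P)%N -> w1 nu * f 0%N nu nu + w2 nu * f nu 0%N nu = 0) ->
  (forall nu, (P <= nu)%N -> f nu nu 0%N = 0) ->
  forall k m, f k m 0%N = 0.
Proof.
move=> c0 fS f1 f2 w0 av fP k m.
have gS k' m' nu : f m' k' nu.+1 = c ^+ 2 * (f m' k'.+1 nu + f m'.+1 k' nu).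
  by rewrite fS addrC.
have [km|mk|<-] := ltngtP k m.
- by apply: (rec_tri c0 fS f1); rewrite addn0.
- by apply: (@rec_tri _ _ (fun k m => f m k) c0 gS f2); rewrite addn0.
have [/fP//|kP] := leqP P k; move: (av k kP).
have /= := rec_diag c0 fS f1 k 0; rewrite add0n => ->.
have /= := @rec_diag _ _ (fun k m => f m k) c0 gS f2 k 0; rewrite add0n => ->.
rewrite mulrCA [X in _ + X]mulrCA -mulrDr -mulrDl => /eqP.
by rewrite !mulf_eq0 expf_eq0 (negPf c0) andbF (negPf (w0 k kP)) => /eqP.
Qed.

(** * Parity of the interpolants at corners and faces *)

Section PatchParity.
Variables (K : numFieldType) (p : nat) (c hx hy : K) (u : {poly {poly K}}).
Variables (i0 j0 : int).
Hypotheses (c0 : c != 0) (hx0 : 0 < hx) (hy0 : 0 < hy) (uV : in_V p u).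

Local Notation L k l nu :=
  (taylor (iter nu (Qop c) u) (i0%:~R * hx) (j0%:~R * hy) k l).

Let LS k l nu : L k l nu.+1 = c ^+ 2 * (L k.+2 l nu + L k l.+2 nu).
Proof. by rewrite iterS taylor_Qop. Qed.

Let L_high k l nu : (2 * p < k)%N || (2 * p < l)%N -> L k l nu = 0.
Proof.
elim: nu k l => [|nu IH] k l h; first exact: taylor_high uV h.
by rewrite LS !IH ?addr0 ?mulr0 //; lia.
Qed.

Let weight_neq0 n m : hy ^+ n + hx ^+ m != 0.
Proof. by rewrite lt0r_neq0 // addr_gt0 // exprn_gt0. Qed.

(* The recursion raises one index by 2, so it preserves the parities [o], [o'] *)
(* of the two indices.                                                         *)
Let row_zerox (o o' : bool) (P : nat) :
  (forall nu l, (nu <= P)%N -> (l <= 2 * p)%N -> odd l = o' -> L o l nu = 0) ->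
  (2 * p < P.+1.*2 + o)%N ->
  forall k l, odd k = o -> odd l = o' -> L k l 0%N = 0.
Proof.
move=> h hP k l ko lo; have [kP|Pk] := leqP k./2 P; last first.
  by apply: L_high; rewrite -[k]odd_double_half ko; lia.
rewrite -[k]odd_double_half -[l]odd_double_half ko lo.
apply: (@rec_row _ c (fun a b nu => L (o + a.*2) (o' + b.*2) nu) c0 _ P _
  k./2 l./2 0%N); last by rewrite addn0.
- by move=> a b nu; rewrite LS !doubleS !addnS.
- move=> nu m hnu; rewrite addn0.
  have [hm|hm] := leqP (o' + m.*2) (2 * p).
    by apply: h => //; rewrite oddD odd_double oddb addbF.
  by apply: L_high; rewrite hm orbT.
Qed.

Let row_zeroy (o o' : bool) (P : nat) :
  (forall nu k, (nu <= P)%N -> (k <= 2 * p)%N -> odd k = o' -> L k o nu = 0) ->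
  (2 * p < P.+1.*2 + o)%N ->
  forall k l, odd k = o' -> odd l = o -> L k l 0%N = 0.
Proof.
move=> h hP k l ko lo; have [lP|Pl] := leqP l./2 P; last first.
  by apply: L_high; rewrite -[l]odd_double_half lo; lia.
rewrite -[k]odd_double_half -[l]odd_double_half ko lo.
apply: (@rec_row _ c (fun b a nu => L (o' + a.*2) (o + b.*2) nu) c0 _ P _
  l./2 k./2 0%N); last by rewrite addn0.
- by move=> a b nu; rewrite LS !doubleS !addnS addrC.
- move=> nu m hnu; rewrite addn0.
  have [hm|hm] := leqP (o' + m.*2) (2 * p).
    by apply: h => //; rewrite oddD odd_double oddb addbF.
  by apply: L_high; rewrite hm.
Qed.

(** Conditions are given only up to order 2p; beyond it the degree bound takes over. In particular,
    for [P <= nu] one of [o + nu.*2] and [o' + nu.*2] exceeds 2p, which settles the rest of the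
    diagonal in [rec_square]. *)
Let square_zero (o o' : bool) (n m : nat -> nat) (P : nat) :
  (forall nu b, (nu < b)%N -> (o' + b.*2 <= 2 * p)%N ->
     L o (o' + b.*2) nu = 0) ->
  (forall nu a, (nu < a)%N -> (o + a.*2 <= 2 * p)%N ->
     L (o + a.*2) o' nu = 0) ->
  (forall nu, (nu < P)%N ->
     hy ^+ n nu * L o (o' + nu.*2) nu + hx ^+ m nu * L (o + nu.*2) o' nu = 0) ->
  (2 * p < P.*2 + maxn o o')%N ->
  forall k l, odd k = o -> odd l = o' -> L k l 0%N = 0.
Proof.
move=> h1 h2 hav hP k l ko lo.
rewrite -[k]odd_double_half -[l]odd_double_half ko lo.
apply: (@rec_square _ c (fun a b nu => L (o + a.*2) (o' + b.*2) nu)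
  (fun nu => hy ^+ n nu) (fun nu => hx ^+ m nu) P c0).
- by move=> a b nu; rewrite LS !doubleS !addnS.
- move=> nu b hb; rewrite addn0; have [le|lt] := leqP (o' + b.*2) (2 * p).
    exact: h1.
  by apply: L_high; rewrite lt orbT.
- move=> nu a ha; rewrite addn0; have [le|lt] := leqP (o + a.*2) (2 * p).
    exact: h2.
  by apply: L_high; rewrite lt.
- by move=> nu _; apply: weight_neq0.
- by move=> nu hnu; rewrite !addn0; apply: hav.
- by move=> nu hnu; apply: L_high; lia.
Qed.

(** Mixed parities are settled by one face alone, because conditions of odd order [mu] are never
    averaged. The averaged ones all fall in the even-even class; the odd-odd class stays free. *)
Lemma corner_DD_parity : corner_DD p c hx hy u i0 j0 ->
  forall k l, ~~ (odd k && odd l) -> taylor u (i0%:~R * hx) (j0%:~R * hy) k l = 0.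
Proof.
move=> h k l.
have {}h nu mu : (nu <= p)%N ->
    ((odd mu && (mu < 2 * nu)) || (2 * nu <= mu <= 2 * p))%N ->
  if mu == (2 * nu)%N then hy ^+ mu * L 0 mu nu + hx ^+ mu * L mu 0 nu = 0
  else L 0 mu nu = 0 /\ L mu 0 nu = 0.
  exact: h.
case ko: (odd k); case lo: (odd l) => //= _.
- apply: (row_zeroy (o := false) (o' := true) (P := p)) ko lo => [nu m hnu hm mo|].
    have := h nu m; rewrite ifN; last by lia.
    by case=> //; lia.
  by lia.
- apply: (row_zerox (o := false) (o' := true) (P := p)) ko lo => [nu m hnu hm mo|].
    have := h nu m; rewrite ifN; last by lia.
    by case=> //; lia.
  by lia.
- apply: (@square_zero false false (fun nu => 2 * nu)%N
    (fun nu => 2 * nu)%N p.+1) ko lo.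
  + move=> nu b hb hp; have := h nu b.*2; rewrite ifN; last by lia.
    by case=> //; lia.
  + move=> nu b hb hp; have := h nu b.*2; rewrite ifN; last by lia.
    by case=> //; lia.
  + move=> nu hnu; have := h nu nu.*2; rewrite mul2n eqxx; apply; lia.
  + by lia.
Qed.

(** Here the averaged conditions fall in the odd-odd class and the even-even class stays free.
    Powers of Q up to [p.-1] suffice because the normal order starts at 1. *)
Lemma corner_NN_parity : (0 < p)%N -> corner_NN p c hx hy u i0 j0 ->
  forall k l, odd k || odd l -> taylor u (i0%:~R * hx) (j0%:~R * hy) k l = 0.
Proof.
move=> p0 h k l; rewrite /corner_NN in h.
have {}h nu mu : (nu < p)%N ->
    ((~~ odd mu && (mu <= 2 * nu)) || (2 * nu + 1 <= mu <= 2 * p))%N ->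
  if mu == (2 * nu + 1)%N then hy ^+ mu * L 1 mu nu + hx ^+ mu * L mu 1 nu = 0
  else L 1 mu nu = 0 /\ L mu 1 nu = 0.
  by move=> hnu hmu; have := h nu mu hnu hmu; rewrite /= iter_DxDy.
case ko: (odd k); case lo: (odd l) => //= _.
- apply: (@square_zero true true (fun nu => 2 * nu + 1)%N
    (fun nu => 2 * nu + 1)%N p) ko lo.
  + move=> nu b hb hp; have := h nu (1 + b.*2)%N; rewrite ifN; last by lia.
    by case=> //; lia.
  + move=> nu b hb hp; have := h nu (1 + b.*2)%N; rewrite ifN; last by lia.
    by case=> //; lia.
  + move=> nu hnu; have := h nu (1 + nu.*2)%N hnu.
    by rewrite mul2n addnC eqxx; apply; lia.
  + by lia.
- apply: (row_zerox (o := true) (o' := false) (P := p.-1)) ko lo => [nu m hnu hm mo|].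
    have := h nu m; rewrite ifN; last by lia.
    by case=> //; lia.
  by lia.
- apply: (row_zeroy (o := true) (o' := false) (P := p.-1)) ko lo => [nu m hnu hm mo|].
    have := h nu m; rewrite ifN; last by lia.
    by case=> //; lia.
  by lia.
Qed.

(** The averaged class is even in x and odd in y. The even-even class needs the extra conditions on
    the p-th power of Q, since [nu < p] reaches only order 2p - 2 in x. *)
Lemma corner_DN_parity : (0 < p)%N -> corner_DN p c hx hy u i0 j0 ->
  forall k l, ~~ odd k || odd l -> taylor u (i0%:~R * hx) (j0%:~R * hy) k l = 0.
Proof.
move=> p0 [h hp] k l.
have {}h nu : (nu < p)%N ->
    [/\ forall mu, ((~~ odd mu && (mu <= 2 * nu)) || (2 * nu + 1 <= mu <= 2 * p))%N ->
          mu != (2 * nu + 1)%N -> L 0 mu nu = 0,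
        forall mu, ((odd mu && (mu < 2 * nu)) || (2 * nu <= mu <= 2 * p))%N ->
          mu != (2 * nu)%N -> L mu 1 nu = 0
      & hy ^+ (2 * nu) * L 0 (2 * nu + 1)%N nu
        + hx ^+ (2 * nu) * L (2 * nu)%N 1 nu = 0].
  move=> /h[h1 h2 h3]; split; first exact: h1.
    by move=> mu hmu hne; have := h2 mu hmu hne; rewrite /= iter_DxDy.
  by move: h3; rewrite /= iter_DxDy.
case ko: (odd k); case lo: (odd l) => //= _.
- apply: (row_zeroy (o := true) (o' := true) (P := p.-1)) ko lo => [nu m hnu hm mo|].
    have [_ h2 _] := h nu ltac:(lia).
    by apply: h2; lia.
  by lia.
- apply: (@square_zero false true (fun nu => 2 * nu)%N
    (fun nu => 2 * nu)%N p) ko lo.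
  + move=> nu b hb hbp; have [h1 _ _] := h nu ltac:(lia).
    by apply: h1; lia.
  + move=> nu b hb hbp; have [_ h2 _] := h nu ltac:(lia).
    by apply: h2; lia.
  + move=> nu hnu; have [_ _] := h nu hnu.
    by rewrite mul2n addnC.
  + by lia.
- apply: (row_zerox (o := false) (o' := false) (P := p)) ko lo => [nu m hnu hm mo|].
    have [lt|ge] := ltnP nu p.
      have [h1 _ _] := h nu lt; apply: h1; lia.
    by rewrite (_ : nu = p); [apply: hp; rewrite ?mo | lia].
  by lia.
Qed.

Lemma face_dirichlet_parity :
  (forall nu mu, (nu <= p)%N -> (mu <= 2 * p)%N ->
     evalg hx hy (iter mu (@Dy K) (iter nu (Qop c) u)) i0 j0 = 0) ->
  forall k l, ~~ odd k -> taylor u (i0%:~R * hx) (j0%:~R * hy) k l = 0.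
Proof.
move=> h k l /negbTE ko; have := erefl (odd l).
by move: ko; apply: (row_zerox (P := p)) => [nu m hnu hm _|]; [exact: h | lia].
Qed.

Lemma face_neumann_parity : (0 < p)%N ->
  (forall nu mu, (nu < p)%N -> (mu <= 2 * p)%N ->
     evalg hx hy (iter mu (@Dy K) (Dx (iter nu (Qop c) u))) i0 j0 = 0) ->
  forall k l, odd k -> taylor u (i0%:~R * hx) (j0%:~R * hy) k l = 0.
Proof.
move=> p0 h k l ko; have := erefl (odd l); move: ko.
by apply: (row_zerox (P := p.-1)) => [nu m hnu hm _|]; [apply: h; lia | lia].
Qed.

End PatchParity.

(** * Ghost values are reflections *)

Section GhostReflection.
Variables (K : numFieldType) (p : nat) (c : K).
Hypotheses (c0 : c != 0) (p0 : (0 < p)%N).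
Implicit Types (U : grid K) (u : {poly {poly K}}) (i j s t : int).
Implicit Types (hx hy : K) (b : bctype).

Definition bsign b : K := (-1) ^+ is_dirichlet b.

Definition ghost_sign b (i : int) : K := if i < 0 then bsign b else 1.

Lemma evalg_parityx (o : bool) u hx hy i0 j0 :
  (forall k l, odd k != o ->
     taylor u (i0%:~R * hx) (j0%:~R * hy) k l = 0) ->
  forall i j, evalg hx hy u (i0 - i) (j0 + j)
    = (-1) ^+ o * evalg hx hy u (i0 + i) (j0 + j).
Proof.
by move=> h i j; rewrite /evalg intrB !intrD mulrBl !mulrDl (taylor_parityx h).
Qed.

Lemma evalg_parityy (o : bool) u hx hy i0 j0 :
  (forall k l, odd l != o ->
     taylor u (i0%:~R * hx) (j0%:~R * hy) k l = 0) ->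
  forall i j, evalg hx hy u (i0 + i) (j0 - j)
    = (-1) ^+ o * evalg hx hy u (i0 + i) (j0 + j).
Proof.
by move=> h i j; rewrite /evalg intrB !intrD mulrBl !mulrDl (taylor_parityy h).
Qed.

Lemma ghost_sign_abs b i0 s (i : int) (f : int -> K) :
  (forall k, f (i0 - k) = bsign b * f (i0 + k)) ->
  f (i0 + s * i) = ghost_sign b i * f (i0 + s * `|i|).
Proof.
rewrite /ghost_sign => h; case: ltrP => [i0'|i0']; last by rewrite ger0_norm ?mul1r.
by rewrite ltr0_norm // -h mulrN opprK.
Qed.

Lemma neg_fix0 (x : K) : x = - x -> x = 0.
Proof. by move/eqP; rewrite -addr_eq0 -mulr2n mulrn_eq0 /= => /eqP. Qed.

Lemma corner_with_reflect hx hy conds bx by_ i0 s j0 t U :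
  (forall u, in_V p u -> conds u i0 j0 -> forall k l,
     (odd k != is_dirichlet bx) || (odd l != is_dirichlet by_) ->
     taylor u (i0%:~R * hx) (j0%:~R * hy) k l = 0) ->
  lcbc_corner_with p hx hy conds bx by_ i0 s j0 t U ->
  (bx = Dirichlet -> forall j : int, 0 <= j <= p%:Z -> U i0 (j0 + t * j) = 0) ->
  (by_ = Dirichlet -> forall i : int, 0 <= i <= p%:Z -> U (i0 + s * i) j0 = 0) ->
  forall i j : int, - p%:Z <= i <= p%:Z - 1 -> - p%:Z <= j <= p%:Z - 1 ->
  U (i0 + s * i) (j0 + t * j) =
    ghost_sign bx i * ghost_sign by_ j * U (i0 + s * `|i|) (j0 + t * `|j|).
Proof.
move=> par [u [uV interp uc ghost]] Dx0 Dy0 i j hi hj.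
have evx := @evalg_parityx (is_dirichlet bx) u hx hy i0 j0
  (fun k l h => par u uV uc k l (introT orP (or_introl h))).
have evy := @evalg_parityy (is_dirichlet by_) u hx hy i0 j0
  (fun k l h => par u uV uc k l (introT orP (or_intror h))).
(* The interpolation conditions omit index 0 in a Dirichlet direction; there [U] vanishes by
   hypothesis and [u] by oddness. *)
have agree (k l : nat) : (k <= p)%N -> (l <= p)%N ->
  evalg hx hy u (i0 + s * k%:Z) (j0 + t * l%:Z) = U (i0 + s * k%:Z) (j0 + t * l%:Z).
  move=> kp lp.
  have [kf|kf] := boolP ((first_index bx <= k)%N && (first_index by_ <= l)%N).
    by apply: interp; lia.
  move: kf; rewrite negb_and -!ltnNge => /orP[].
    case: (bx) Dx0 evx => //= /(_ erefl) Dx0 evx; rewrite ltnS leqn0 => /eqP->.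
    rewrite mulr0 addr0 Dx0; last by lia.
    by apply: neg_fix0; have := evx 0 (t * l%:Z); rewrite oppr0 !addr0 mulN1r.
  case: (by_) Dy0 evy => //= /(_ erefl) Dy0 evy; rewrite ltnS leqn0 => /eqP->.
  rewrite mulr0 addr0 Dy0; last by lia.
  by apply: neg_fix0; have := evy (s * k%:Z) 0; rewrite oppr0 !addr0 mulN1r.
have [gh|] := boolP ((i < 0) || (j < 0)); last first.
  rewrite negb_or -!leNgt => /andP[i0' j0'].
  by rewrite /ghost_sign !ltNge i0' j0' !mul1r !ger0_norm.
rewrite ghost //.
rewrite (@ghost_sign_abs bx i0 s i (fun k => evalg hx hy u k (j0 + t * j))) //.
rewrite (@ghost_sign_abs by_ j0 t j (fun k => evalg hx hy u (i0 + s * `|i|) k)) //.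
by rewrite -mulrA -!abszE agree //; lia.
Qed.

Lemma lcbc_corner_reflect hx hy bx by_ i0 s j0 t U :
  0 < hx -> 0 < hy ->
  lcbc_corner p c hx hy bx by_ i0 s j0 t U ->
  (bx = Dirichlet -> forall j : int, 0 <= j <= p%:Z -> U i0 (j0 + t * j) = 0) ->
  (by_ = Dirichlet -> forall i : int, 0 <= i <= p%:Z -> U (i0 + s * i) j0 = 0) ->
  forall i j : int, - p%:Z <= i <= p%:Z - 1 -> - p%:Z <= j <= p%:Z - 1 ->
  U (i0 + s * i) (j0 + t * j) =
    ghost_sign bx i * ghost_sign by_ j * U (i0 + s * `|i|) (j0 + t * `|j|).
Proof.
move=> hx0 hy0; case: bx; case: by_ => /= h Dx0 Dy0 i j hi hj.
- apply: (corner_with_reflect _ h) hi hj => // u uV cu k l kl.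
  apply: (corner_DD_parity c0 hx0 hy0 uV cu).
  by move: kl; case: (odd k); case: (odd l).
- apply: (corner_with_reflect _ h) hi hj => // u uV cu k l kl.
  apply: (corner_DN_parity c0 hx0 hy0 uV p0 cu).
  by move: kl; case: (odd k); case: (odd l).
(* The Neumann-Dirichlet corner is defined on the transposed grid, so the mixed case is reused with
   the coordinates exchanged. *)
- rewrite [ghost_sign _ i * _]mulrC.
  apply: (@corner_with_reflect hy hx _ Dirichlet Neumann j0 t i0 s (transpose U)
    _ h) hj hi => // u uV cu k l kl.
  apply: (corner_DN_parity c0 hy0 hx0 uV p0 cu).
  by move: kl; case: (odd k); case: (odd l).
- apply: (corner_with_reflect _ h) hi hj => // u uV cu k l kl.
  apply: (corner_NN_parity c0 hx0 hy0 uV p0 cu).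
  by move: kl; case: (odd k); case: (odd l).
Qed.

Lemma poly_few_zeros (q : {poly K}) (h y : K) : h != 0 ->
  (size q <= (2 * p).+1)%N ->
  (forall j : int, `|j| <= p%:Z -> q.[y + j%:~R * h] = 0) -> q = 0.
Proof.
move=> h0 sq q0; apply/eqP; apply: contraT => nz.
pose rs := [seq y + (k%:Z - p%:Z)%:~R * h | k <- iota 0 (2 * p).+1].
have := @max_poly_roots _ q rs nz; rewrite size_map size_iota ltnNge sq.
apply.
  apply/allP=> z /mapP[k]; rewrite mem_iota => hk ->.
  by rewrite /root q0 //; lia.
rewrite map_inj_uniq ?iota_uniq // => k l /addrI /(mulIf h0) /intr_inj; lia.
Qed.

Lemma lcbc_face_reflect hx hy b N i0 s U :
  0 < hx -> 0 < hy ->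
  lcbc_face p c hx hy b N i0 s U ->
  (b = Dirichlet -> forall j : int, 0 <= j <= N%:Z -> U i0 j = 0) ->
  forall i j : int, - p%:Z <= i <= p%:Z -> p%:Z <= j <= N%:Z - p%:Z ->
  U (i0 + s * i) j = ghost_sign b i * U (i0 + s * `|i|) j.
Proof.
move=> hx0 hy0 face D0 i [j|j] hi hj; last by lia.
have [|| u [uV interp cond ghost]] := face j; [lia | lia |].
have [i_ge0|i_lt0] := leP 0 i.
  by rewrite /ghost_sign ltNge i_ge0 mul1r ger0_norm.
have par k l : odd k != is_dirichlet b ->
    taylor u (i0%:~R * hx) (j%:Z%:~R * hy) k l = 0.
  case: b D0 cond {face ghost} => /= [D0 cond ko|_ cond ko].
    apply: (face_dirichlet_parity c0 hx0 hy0 uV); last by move: ko; case: odd.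
    move=> [|nu] mu hnu hmu; last by apply: cond.
    (* The imposed conditions start at [nu = 1]. For [nu = 0], the trace of [u] on the face has
       degree at most 2p and vanishes at 2p + 1 points. *)
    rewrite /evalg horner_iterDy /=.
    rewrite (_ : u.[(i0%:~R * hx)%:P] = 0) ?linear0 ?horner0 //.
    apply: (@poly_few_zeros _ hy (j%:Z%:~R * hy)); first by rewrite gt_eqF.
      by apply: leq_trans (max_size_evalC _ _) (proj2 uV).
    move=> m hm; have := interp 0%N m isT hm; rewrite mulr0 addr0 /evalg.
    by rewrite intrD mulrDl D0 //; lia.
  apply: (face_neumann_parity c0 hx0 hy0 uV p0); last by move: ko; case: odd.
  exact: cond.
have ev k : evalg hx hy u (i0 - k) j = bsign b * evalg hx hy u (i0 + k) j.
  by have := evalg_parityx par k 0; rewrite addr0.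
have hU : U (i0 + s * i) j = evalg hx hy u (i0 + s * i) j.
  by have := ghost `|i|%N; rewrite abszE ltr0_norm // mulrN opprK; apply; lia.
rewrite hU (@ghost_sign_abs b i0 s i (fun k => evalg hx hy u k j)) //.
have := interp `|i|%N 0; rewrite addr0 abszE => -> //; lia.
Qed.

End GhostReflection.

(** * Reflection and stencils *)

Section Fold.
Variables (K : fieldType) (sl sr : K) (N : nat).
Hypotheses (sl2 : sl * sl = 1) (sr2 : sr * sr = 1) (N0 : (0 < N)%N).

(** The triangle wave of period 2N. *)
Definition fold (i : int) : int :=
  let r := (i %% (2 * N%:Z)%R)%Z in if r <= N%:Z then r else 2 * N%:Z - r.

(** A full period amounts to one reflection at each end, hence [sl * sr]; the descending half of the
    wave adds one reflection at N. *)
Definition fold_sign (i : int) : K :=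
  (sl * sr) ^ (i %/ (2 * N%:Z)%R)%Z
  * (if (i %% (2 * N%:Z)%R)%Z <= N%:Z then 1 else sr).

Lemma foldE (q r : int) : 0 <= r < 2 * N%:Z ->
  fold (q * (2 * N%:Z) + r) = (if r <= N%:Z then r else 2 * N%:Z - r) /\
  fold_sign (q * (2 * N%:Z) + r) =
    (sl * sr) ^ q * (if r <= N%:Z then 1 else sr).
Proof.
move=> hr; rewrite /fold /fold_sign.
have M0 : 2 * N%:Z != 0 :> int by lia.
by rewrite modzMDl divzMDl // modz_small ?divz_small ?addr0 //; lia.
Qed.

Lemma fold_range i : 0 <= fold i <= N%:Z.
Proof.
have M0 : 2 * N%:Z != 0 :> int by lia.
have M0' : 0 < 2 * N%:Z :> int by lia.
have : 0 <= (i %% (2 * N%:Z)%R)%Z < 2 * N%:Z by rewrite modz_ge0 ?ltz_pmod.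
rewrite /fold; move: (i %% _)%Z => r hr; case: (lerP r N); lia.
Qed.

Lemma fold_id i : 0 <= i <= N%:Z -> fold i = i /\ fold_sign i = 1.
Proof.
move=> hi; have := @foldE 0 i; rewrite mul0r add0r => -[|-> ->]; first by lia.
by have [_ ->] := andP hi; rewrite expr0z mulr1.
Qed.

Lemma fold_cases (i : int) : exists q r : int,
  0 <= r < 2 * N%:Z /\ i = q * (2 * N%:Z) + r.
Proof.
have M0 : 2 * N%:Z != 0 :> int by lia.
have M0' : 0 < 2 * N%:Z :> int by lia.
exists (i %/ (2 * N%:Z)%R)%Z, (i %% (2 * N%:Z)%R)%Z; split; last exact: divz_eq.
by rewrite modz_ge0 ?ltz_pmod.
Qed.

Let e := sl * sr.
Let ee : e * e = 1. Proof. by rewrite /e mulrACA sl2 sr2 mulr1. Qed.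
Let e0 : e != 0.
Proof. by apply: contra_eqN ee => /eqP->; rewrite mul0r eq_sym oner_eq0. Qed.
Let eV (q : int) : e ^ (- q) = e ^ q.
Proof. by rewrite -exprz_inv; congr (_ ^ q); apply: (mulfI e0); rewrite ee divff. Qed.

Variable g : int -> K.
Hypotheses (g0 : sl * g 0 = g 0) (gN : sr * g N%:Z = g N%:Z).

(** Negation turns quotient q and remainder r into -q - 1 and 2N - r, except that r = 0 stays 0. At
    the turning points r = 0 and r = N the signs are reconciled by [g0] and [gN]. *)
Lemma fold_reflect0 i :
  fold_sign (- i) * g (fold (- i)) = sl * (fold_sign i * g (fold i)).
Proof.
have [q [r [hr ->]]] := fold_cases i; have [-> ->] := foldE q hr.
have [r0|r0] := eqVneq r 0.
  have -> : - (q * (2 * N%:Z) + r) = - q * (2 * N%:Z) + r by rewrite r0; ring.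
  have [-> ->] := foldE (- q) hr; rewrite -/e eV r0 /= !mulr1.
  by rewrite mulrCA g0.
have -> : - (q * (2 * N%:Z) + r) = (- q - 1) * (2 * N%:Z) + (2 * N%:Z - r) by ring.
have [|-> ->] := @foldE (- q - 1) (2 * N%:Z - r); first by lia.
rewrite -/e expfzDr // eV eV expr1z.
have [rN|rN|rN] := ltgtP r N%:Z.
- have -> : (2 * N%:Z - r <= N%:Z) = false by apply/negbTE; lia.
  by rewrite opprB addrCA subrr addr0 /e mulr1 -[RHS]mul1r -sr2; ring.
- have -> : (2 * N%:Z - r <= N%:Z) = true by lia.
  by rewrite /e; ring.
- have -> : 2 * N%:Z - r = N%:Z by rewrite rN; ring.
  rewrite lexx rN.
  by rewrite -[in RHS]gN /e; ring.
Qed.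

Lemma fold_reflectN i :
  fold_sign (2 * N%:Z - i) * g (fold (2 * N%:Z - i))
    = sr * (fold_sign i * g (fold i)).
Proof.
have [q [r [hr ->]]] := fold_cases i; have [-> ->] := foldE q hr.
have [r0|r0] := eqVneq r 0.
  have -> : 2 * N%:Z - (q * (2 * N%:Z) + r) = (1 - q) * (2 * N%:Z) + r.
    by rewrite r0; ring.
  have [-> ->] := foldE (1 - q) hr; rewrite -/e expfzDr // eV r0 /= !mulr1.
  by rewrite expr1z /e -[in RHS]g0; ring.
have -> : 2 * N%:Z - (q * (2 * N%:Z) + r) = (- q) * (2 * N%:Z) + (2 * N%:Z - r).
  by ring.
have [|-> ->] := @foldE (- q) (2 * N%:Z - r); first by lia.
rewrite -/e eV.
have [rN|rN|rN] := ltgtP r N%:Z.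
- have -> : (2 * N%:Z - r <= N%:Z) = false by apply/negbTE; lia.
  by rewrite opprB addrCA subrr addr0; ring.
- have -> : (2 * N%:Z - r <= N%:Z) = true by lia.
  by rewrite mulr1 -[LHS]mul1r -sr2; ring.
- have -> : 2 * N%:Z - r = N%:Z by rewrite rN; ring.
  rewrite lexx rN.
  by rewrite -[in LHS]gN; ring.
Qed.

End Fold.

(* A syntax for the operators of the scheme: locality, invariance under          *)
(* reflections and the Fourier multiplier are then one induction each.  Widths   *)
(* in x and y are separate because [bilap4] contains X^2 Y^2, which a total      *)
(* width of 3 would not accommodate.                                             *)
Inductive stencil (K : Type) :=
| SId
| SX of stencil K
| SY of stencil K
| SAdd of stencil K & stencil K
| SSub of stencil K & stencil K
| SScale of K & stencil K.
Arguments SId {K}.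

Fixpoint width_x K (e : stencil K) : nat :=
  match e with
  | SId => 0
  | SX e => (width_x e).+1
  | SY e | SScale _ e => width_x e
  | SAdd e f | SSub e f => maxn (width_x e) (width_x f)
  end.

Fixpoint width_y K (e : stencil K) : nat :=
  match e with
  | SId => 0
  | SY e => (width_y e).+1
  | SX e | SScale _ e => width_y e
  | SAdd e f | SSub e f => maxn (width_y e) (width_y f)
  end.

Section StencilOperators.
Variable K : fieldType.
Variables dx dy : K.
Implicit Types (U V : grid K) (e : stencil K).

Fixpoint apply_stencil e U : grid K :=
  match e with
  | SId => U
  | SX e => Xdiff dx (apply_stencil e U)
  | SY e => Ydiff dy (apply_stencil e U)
  | SAdd e f => fun i j => apply_stencil e U i j + apply_stencil f U i j
  | SSub e f => fun i j => apply_stencil e U i j - apply_stencil f U i j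
  | SScale a e => fun i j => a * apply_stencil e U i j
  end.

Fixpoint symbol (a b : K) e : K :=
  match e with
  | SId => 1
  | SX e => a * symbol a b e
  | SY e => b * symbol a b e
  | SAdd e f => symbol a b e + symbol a b f
  | SSub e f => symbol a b e - symbol a b f
  | SScale k e => k * symbol a b e
  end.

Definition Slap2 e := SAdd (SX e) (SY e).
Definition SX4 e := SX (SSub e (SScale (dx ^+ 2 / 12) (SX e))).
Definition SY4 e := SY (SSub e (SScale (dy ^+ 2 / 12) (SY e))).
Definition SX6 e := SX (SAdd (SSub e (SScale (dx ^+ 2 / 12) (SX e)))
                              (SScale (dx ^+ 4 / 90) (SX (SX e)))).
Definition SY6 e := SY (SAdd (SSub e (SScale (dy ^+ 2 / 12) (SY e)))
                              (SScale (dy ^+ 4 / 90) (SY (SY e)))).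
Definition Sbilap4 e :=
  SAdd (SAdd (SX (SX (SSub e (SScale (dx ^+ 2 / 6) (SX e)))))
             (SY (SY (SSub e (SScale (dy ^+ 2 / 6) (SY e))))))
       (SScale 2 (SX4 (SY4 e))).

(** Written so that each case unfolds to [me_rhs] by conversion. *)
Definition me_stencil (c dt : K) (p : nat) : stencil K :=
  match p with
  | 1%N => SScale (c ^+ 2) (Slap2 SId)
  | 2%N => SAdd (SScale (c ^+ 2) (SAdd (SX4 SId) (SY4 SId)))
                (SScale (dt ^+ 2 / 12 * c ^+ 4) (Slap2 (Slap2 SId)))
  | 3%N => SAdd (SAdd (SScale (c ^+ 2) (SAdd (SX6 SId) (SY6 SId)))
                      (SScale (dt ^+ 2 / 12 * c ^+ 4) (Sbilap4 SId)))
                (SScale (dt ^+ 4 / 360 * c ^+ 6) (Slap2 (Slap2 (Slap2 SId))))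
  | _ => SScale 0 SId
  end.

Lemma me_stencilE c dt p U i j :
  (1 <= p <= 3)%N -> me_rhs c dx dy dt p U i j = apply_stencil (me_stencil c dt p) U i j.
Proof. by case: p => [|[|[|[|p]]]]. Qed.

(** The reach in each direction is within the p ghost lines, so an update at a grid point sees only
    values where [phi] is a reflection. *)
Lemma me_stencil_width c dt p : (width_x (me_stencil c dt p) <= p)%N /\
  (width_y (me_stencil c dt p) <= p)%N.
Proof. by case: p => [|[|[|[|p]]]]. Qed.

Lemma apply_scale e k U i j :
  apply_stencil e (fun i j => k * U i j) i j = k * apply_stencil e U i j.
Proof.
elim: e i j => //= [e IH|e IH|e IHe f IHf|e IHe f IHf|a e IH] i j.
- by rewrite /Xdiff !IH; ring.
- by rewrite /Ydiff !IH; ring.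
- by rewrite IHe IHf mulrDr.
- by rewrite IHe IHf mulrBr.
- by rewrite IH mulrCA.
Qed.

Section Locality.
Variables Nx Ny : nat.

Definition eq_box (a b : nat) U V := forall i j : int,
  - a%:Z <= i <= Nx%:Z + a%:Z -> - b%:Z <= j <= Ny%:Z + b%:Z -> U i j = V i j.

Lemma eq_boxW a b a' b' U V : eq_box a b U V -> (a' <= a)%N -> (b' <= b)%N ->
  eq_box a' b' U V.
Proof. by move=> h ha hb i j hi hj; apply: h; lia. Qed.

Lemma apply_local e a b U V : eq_box (a + width_x e) (b + width_y e) U V ->
  eq_box a b (apply_stencil e U) (apply_stencil e V).
Proof.
elim: e a b => /= [a b|e IH a b h|e IH a b h|e IHe f IHf a b h|e IHe f IHf a b h|k e IH a b h].
- by rewrite !addn0.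
- have {}h : eq_box a.+1 b (apply_stencil e U) (apply_stencil e V) by apply: IH; rewrite addSnnS.
  by move=> i j hi hj; rewrite /Xdiff !h //; lia.
- have {}h : eq_box a b.+1 (apply_stencil e U) (apply_stencil e V) by apply: IH; rewrite addSnnS.
  by move=> i j hi hj; rewrite /Ydiff !h //; lia.
- by move=> i j hi hj; congr (_ + _); [apply: (IHe a b) | apply: (IHf a b)] => //;
    move=> k l hk hl; apply: h; lia.
- by move=> i j hi hj; congr (_ - _); [apply: (IHe a b) | apply: (IHf a b)] => //;
    move=> k l hk hl; apply: h; lia.
- by move=> i j hi hj; congr (_ * _); apply: (IH a b).
Qed.

End Locality.

Definition reflectx (k : int) (s : K) U := forall i j, U (k - i) j = s * U i j.
Definition reflecty (k : int) (s : K) U := forall i j, U i (k - j) = s * U i j.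

Lemma apply_reflectx e k s U : reflectx k s U -> reflectx k s (apply_stencil e U).
Proof.
move=> h; elim: e => //= [e IH|e IH|e IHe f IHf|e IHe f IHf|a e IH] i j.
- rewrite /Xdiff (_ : k - i + 1 = k - (i - 1)); last by ring.
  by rewrite (_ : k - i - 1 = k - (i + 1)) ?IH; ring.
- by rewrite /Ydiff !IH; ring.
- by rewrite IHe IHf mulrDr.
- by rewrite IHe IHf mulrBr.
- by rewrite IH mulrCA.
Qed.

Lemma apply_reflecty e k s U : reflecty k s U -> reflecty k s (apply_stencil e U).
Proof.
move=> h; elim: e => //= [e IH|e IH|e IHe f IHf|e IHe f IHf|a e IH] i j.
- by rewrite /Xdiff !IH; ring.
- rewrite /Ydiff (_ : k - j + 1 = k - (j - 1)); last by ring.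
  by rewrite (_ : k - j - 1 = k - (j + 1)) ?IH; ring.
- by rewrite IHe IHf mulrDr.
- by rewrite IHe IHf mulrBr.
- by rewrite IH mulrCA.
Qed.

End StencilOperators.

(** The two reflections generate an infinite dihedral group with fundamental domain [[0, N]]. Beyond
    N, reflecting at N, followed by a reflection at 0 if the result is negative, strictly decreases
    the index. *)
Lemma int_reflect_ind (N : nat) (P : int -> Prop) : (0 < N)%N ->
  (forall i, P i -> P (0 - i)) -> (forall i, P i -> P (2 * N%:Z - i)) ->
  (forall i, 0 <= i <= N%:Z -> P i) -> forall i, P i.
Proof.
move=> N0 P0 PN Pin i.
suff pos k : 0 <= k -> P k.
  have [|/ltW i0] := lerP 0 i; first exact: pos.
  by rewrite (_ : i = 0 - - i); [apply/P0/pos; rewrite oppr_ge0 | ring].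
case: k => [k _|//]; elim/ltn_ind: k => k IH.
have [kN|kN] := leqP k N; first by apply: Pin; lia.
rewrite -[k%:Z](subKr (2 * N%:Z)); apply: PN.
have [k2|k2] := leqP k (2 * N).
  rewrite (_ : 2 * N%:Z - k%:Z = (2 * N - k)%N%:Z); last by lia.
  by apply: IH; lia.
rewrite (_ : 2 * N%:Z - k%:Z = 0 - (k - 2 * N)%N%:Z); last by lia.
by apply/P0/IH; lia.
Qed.

(** * Extension of a mode by reflections *)

Section Extension.
Variables (K : numFieldType) (p Nx Ny : nat) (bcs : boundary).
Variables (c dx dy : K) (phi : grid K).
Hypotheses (c0 : c != 0) (dx0 : 0 < dx) (dy0 : 0 < dy).
Hypotheses (p0 : (0 < p)%N) (pNx : (p <= Nx)%N) (pNy : (p <= Ny)%N).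
Hypothesis bc : discrete_bc p bcs c dx dy Nx Ny phi.

Let bl := bc_left bcs. Let br := bc_right bcs.
Let bb := bc_bottom bcs. Let bt := bc_top bcs.
Let Nx0 : (0 < Nx)%N. Proof. exact: leq_trans pNx. Qed.
Let Ny0 : (0 < Ny)%N. Proof. exact: leq_trans pNy. Qed.

Lemma bsign2 b : bsign K b * bsign K b = 1.
Proof. by case: b; rewrite /bsign /= ?mulrNN mulr1. Qed.

Lemma bsign_fix b (x : K) : (b = Dirichlet -> x = 0) -> bsign K b * x = x.
Proof. by case: b => [->//|_]; rewrite ?mulr0 // mul1r. Qed.

Let dir_left : bl = Dirichlet -> forall j : int, 0 <= j <= Ny%:Z -> phi 0 j = 0.
Proof.
rewrite /bl; case: bc => h _ _ e j hj; apply: h.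
by rewrite /on_dirichlet /on_grid hj e eqxx.
Qed.
Let dir_right : br = Dirichlet ->
  forall j : int, 0 <= j <= Ny%:Z -> phi Nx%:Z j = 0.
Proof.
rewrite /br; case: bc => h _ _ e j hj; apply: h.
by rewrite /on_dirichlet /on_grid hj e eqxx lexx !orbT !andbT; lia.
Qed.
Let dir_bottom : bb = Dirichlet ->
  forall i : int, 0 <= i <= Nx%:Z -> phi i 0 = 0.
Proof.
rewrite /bb; case: bc => h _ _ e i hi; apply: h.
by rewrite /on_dirichlet /on_grid hi e eqxx !orbT.
Qed.
Let dir_top : bt = Dirichlet ->
  forall i : int, 0 <= i <= Nx%:Z -> phi i Ny%:Z = 0.
Proof.
rewrite /bt; case: bc => h _ _ e i hi; apply: h.
by rewrite /on_dirichlet /on_grid hi e eqxx lexx !orbT !andbT; lia.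
Qed.

(* On a Dirichlet line the two formulas for [fold_sign] on its two sides differ  *)
(* by a sign, which is harmless since [phi] vanishes there.                      *)
Definition extension : grid K := fun i j =>
  fold_sign (bsign K bl) (bsign K br) Nx i
  * (fold_sign (bsign K bb) (bsign K bt) Ny j * phi (fold Nx i) (fold Ny j)).

Lemma extension_grid i j : 0 <= i <= Nx%:Z -> 0 <= j <= Ny%:Z ->
  extension i j = phi i j.
Proof.
move=> hi hj; rewrite /extension.
have [-> ->] := fold_id (bsign K bl) (bsign K br) Nx0 hi.
by have [-> ->] := fold_id (bsign K bb) (bsign K bt) Ny0 hj; rewrite !mul1r.
Qed.

Lemma extension_left : reflectx 0 (bsign K bl) extension.
Proof.
move=> i j; rewrite /extension sub0r [LHS]mulrCA.
rewrite (fold_reflect0 (bsign2 bl) (bsign2 br) Nx0 (g := fun i => phi i (fold Ny j))); first by ring.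
  by apply: bsign_fix => e; apply: dir_left => //; apply: fold_range.
by apply: bsign_fix => e; apply: dir_right => //; apply: fold_range.
Qed.

Lemma extension_right : reflectx (2 * Nx%:Z) (bsign K br) extension.
Proof.
move=> i j; rewrite /extension [LHS]mulrCA.
rewrite (fold_reflectN (bsign2 bl) (bsign2 br) Nx0 (g := fun i => phi i (fold Ny j))); first by ring.
  by apply: bsign_fix => e; apply: dir_left => //; apply: fold_range.
by apply: bsign_fix => e; apply: dir_right => //; apply: fold_range.
Qed.

Lemma extension_bottom : reflecty 0 (bsign K bb) extension.
Proof.
move=> i j; rewrite /extension sub0r [RHS]mulrCA; congr (_ * _).
apply: (fold_reflect0 (bsign2 bb) (bsign2 bt) Ny0 (g := phi (fold Nx i))).
  by apply: bsign_fix => e; apply: dir_bottom => //; apply: fold_range.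
by apply: bsign_fix => e; apply: dir_top => //; apply: fold_range.
Qed.

Lemma extension_top : reflecty (2 * Ny%:Z) (bsign K bt) extension.
Proof.
move=> i j; rewrite /extension [RHS]mulrCA; congr (_ * _).
apply: (fold_reflectN (bsign2 bb) (bsign2 bt) Ny0 (g := phi (fold Nx i))).
  by apply: bsign_fix => e; apply: dir_bottom => //; apply: fold_range.
by apply: bsign_fix => e; apply: dir_top => //; apply: fold_range.
Qed.

Let ghost_left (i j : int) :
  extension (0 + 1 * i) j = ghost_sign K bl i * extension (0 + 1 * `|i|) j.
Proof.
apply: (@ghost_sign_abs _ bl 0 1 i (extension^~ j)) => k.
by rewrite [0 + k]add0r; apply: extension_left.
Qed.
Let ghost_right (i j : int) :
  extension (Nx%:Z + -1 * i) j
    = ghost_sign K br i * extension (Nx%:Z + -1 * `|i|) j.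
Proof.
apply: (@ghost_sign_abs _ br Nx%:Z (-1) i (extension^~ j)) => k.
by rewrite -extension_right; congr extension; ring.
Qed.
Let ghost_bottom (i j : int) :
  extension i (0 + 1 * j) = ghost_sign K bb j * extension i (0 + 1 * `|j|).
Proof.
apply: (@ghost_sign_abs _ bb 0 1 j (extension i)) => k.
by rewrite [0 + k]add0r; apply: extension_bottom.
Qed.
Let ghost_top (i j : int) :
  extension i (Ny%:Z + -1 * j)
    = ghost_sign K bt j * extension i (Ny%:Z + -1 * `|j|).
Proof.
apply: (@ghost_sign_abs _ bt Ny%:Z (-1) j (extension i)) => k.
by rewrite -extension_top; congr extension; ring.
Qed.

(** The split follows the LCBC patches: corner patches set ghost values at tangential indices up to
    p - 1 from a corner, and face patches take over from p on. *)
Let side (N : nat) (i : int) : (p <= N)%N -> - p%:Z <= i <= N%:Z + p%:Z ->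
  [\/ exists2 k : int, - p%:Z <= k <= p%:Z - 1 & i = 0 + 1 * k,
      exists2 k : int, - p%:Z <= k <= p%:Z - 1 & i = N%:Z + -1 * k
    | p%:Z <= i <= N%:Z - p%:Z].
Proof.
move=> hN hi; have [h|h] := lerP i (p%:Z - 1).
  by constructor 1; exists i; [lia | ring].
have [h'|h'] := lerP (N%:Z - p%:Z + 1) i.
  by constructor 2; exists (N%:Z - i); [lia | ring].
by constructor 3; lia.
Qed.

(** Nine regions: four corners, four faces and the interior. The bounds [pNx] and [pNy] keep each
    mirror point, at distance at most p from its face, inside the grid. *)
Lemma extension_box : eq_box Nx Ny p p phi extension.
Proof.
have [_ [fl fr fb ft] [clb crb clt crt]] := bc.
move=> i j hi hj.
have [[k hk ->]|[k hk ->]|hi'] := side pNx hi;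
  have [[l hl ->]|[l hl ->]|hj'] := side pNy hj.
- rewrite ghost_left ghost_bottom mulrA extension_grid; [|lia|lia].
  apply: (lcbc_corner_reflect c0 p0 dx0 dy0 clb) => // e m hm.
    by apply: dir_left => //; lia.
  by apply: dir_bottom => //; lia.
- rewrite ghost_left ghost_top mulrA extension_grid; [|lia|lia].
  apply: (lcbc_corner_reflect c0 p0 dx0 dy0 clt) => // e m hm.
    by apply: dir_left => //; lia.
  by apply: dir_top => //; lia.
- rewrite ghost_left extension_grid; [|lia|lia].
  by apply: (lcbc_face_reflect c0 p0 dx0 dy0 fl) => //; lia.
- rewrite ghost_right ghost_bottom mulrA extension_grid; [|lia|lia].
  apply: (lcbc_corner_reflect c0 p0 dx0 dy0 crb) => // e m hm.
    by apply: dir_right => //; lia.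
  by apply: dir_bottom => //; lia.
- rewrite ghost_right ghost_top mulrA extension_grid; [|lia|lia].
  apply: (lcbc_corner_reflect c0 p0 dx0 dy0 crt) => // e m hm.
    by apply: dir_right => //; lia.
  by apply: dir_top => //; lia.
- rewrite ghost_right extension_grid; [|lia|lia].
  by apply: (lcbc_face_reflect c0 p0 dx0 dy0 fr) => //; lia.
- rewrite ghost_bottom extension_grid; [|lia|lia].
  by apply: (lcbc_face_reflect c0 p0 dy0 dx0 fb) => //; lia.
- rewrite ghost_top extension_grid; [|lia|lia].
  by apply: (lcbc_face_reflect c0 p0 dy0 dx0 ft) => //; lia.
- by rewrite extension_grid //; lia.
Qed.

Variables (e : stencil K) (lam : K).
Hypotheses (ex : (width_x e <= p)%N) (ey : (width_y e <= p)%N).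
Hypothesis eig : forall i j, on_grid Nx Ny i j -> ~~ on_dirichlet bcs Nx Ny i j ->
  apply_stencil dx dy e phi i j = lam * phi i j.

Let M := apply_stencil dx dy e extension.

Let M_grid i j : 0 <= i <= Nx%:Z -> 0 <= j <= Ny%:Z ->
  M i j = lam * extension i j.
Proof.
move=> hi hj; have hg : on_grid Nx Ny i j by rewrite /on_grid hi hj.
have [hd|hd] := boolP (on_dirichlet bcs Nx Ny i j); last first.
  rewrite extension_grid // -eig //; apply/esym.
  apply: (@apply_local _ dx dy Nx Ny e 0 0 phi extension); [|lia|lia].
  exact: eq_boxW extension_box ex ey.
(* The scheme says nothing at a Dirichlet point. There [M] inherits oddness about the face from the
   extension, so both sides vanish. *)
rewrite extension_grid //; case: (bc) => -> // _ _; rewrite mulr0.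
apply: neg_fix0; rewrite -mulN1r.
move: hd; rewrite /on_dirichlet hg /= => /or4P[] /andP[/eqP-> hb].
- have := apply_reflectx dx dy e extension_left 0 j.
  by rewrite subr0 /bl /bsign hb.
- have := apply_reflectx dx dy e extension_right Nx%:Z j.
  by rewrite (_ : 2 * Nx%:Z - Nx%:Z = Nx%:Z) /br /bsign ?hb //; ring.
- have := apply_reflecty dx dy e extension_bottom i 0.
  by rewrite subr0 /bb /bsign hb.
- have := apply_reflecty dx dy e extension_top i Ny%:Z.
  by rewrite (_ : 2 * Ny%:Z - Ny%:Z = Ny%:Z) /bt /bsign ?hb //; ring.
Qed.

(** Both sides pick up the same sign under each reflection, so the equation spreads from the grid to
    the whole plane. *)
Lemma extension_eigen i j : M i j = lam * extension i j.
Proof.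
move: i j; apply: (int_reflect_ind Nx0) => [i h j|i h j|i hi].
- rewrite /M (apply_reflectx dx dy e extension_left) extension_left.
  by rewrite -/M h mulrCA.
- rewrite /M (apply_reflectx dx dy e extension_right) extension_right.
  by rewrite -/M h mulrCA.
apply: (int_reflect_ind Ny0) => [j h|j h|j hj].
- rewrite /M (apply_reflecty dx dy e extension_bottom) extension_bottom.
  by rewrite -/M h mulrCA.
- rewrite /M (apply_reflecty dx dy e extension_top) extension_top.
  by rewrite -/M h mulrCA.
- exact: M_grid.
Qed.

End Extension.

(** Two reflections compose to a translation by 2N with factor [sr * sl], which may be -1; hence the
    period 4N. *)
Lemma reflectx_periodic (K : fieldType) (N : nat) (sl sr : K) (U : grid K) :
  sl * sl = 1 -> sr * sr = 1 ->
  reflectx 0 sl U -> reflectx (2 * N%:Z) sr U ->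
  forall i j, U (i + (4 * N)%N%:Z) j = U i j.
Proof.
move=> sl2 sr2 h0 hN.
have h i j : U (i + 2 * N%:Z) j = sr * sl * U i j.
  by rewrite -mulrA -h0 -hN; congr U; ring.
move=> i j; rewrite (_ : i + _ = i + 2 * N%:Z + 2 * N%:Z); last by lia.
by rewrite !h mulrA mulrACA sl2 sr2 !mul1r.
Qed.

Lemma reflecty_periodic (K : fieldType) (N : nat) (sl sr : K) (U : grid K) :
  sl * sl = 1 -> sr * sr = 1 ->
  reflecty 0 sl U -> reflecty (2 * N%:Z) sr U ->
  forall i j, U i (j + (4 * N)%N%:Z) = U i j.
Proof.
move=> sl2 sr2 h0 hN i j.
by apply: (@reflectx_periodic _ N sl sr (transpose U)) => // ? ?;
  [apply: h0 | apply: hN].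
Qed.

(** * Discrete Fourier transform *)

Section Fourier.
Variable C : numClosedFieldType.

Lemma unity_roots (n : nat) : (0 < n)%N ->
  exists rs : seq C, [/\ uniq rs, size rs = n & forall z, z \in rs -> z ^+ n = 1].
Proof.
move=> n0; pose q : {poly C} := 'X^n - 1; have [rs Dq] := closed_field_poly_normal q.
rewrite (monicP _) ?monicXnsubC // scale1r in Dq.
exists rs; split.
- by rewrite -separable_prod_XsubC -Dq separable_Xn_sub_1 // pnatr_eq0 -lt0n.
- by apply: succn_inj; rewrite -(size_prod_XsubC rs id) -Dq size_XnsubC.
- move=> z; rewrite -root_prod_XsubC -Dq /root !hornerE subr_eq0.
  by move/eqP.
Qed.

(** Injectivity of the transform: a polynomial of degree below n with n distinct roots is zero. *)
Lemma unity_sum_eq0 (n : nat) (f : nat -> C) :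
  (forall z, z ^+ n = 1 -> \sum_(i < n) f i * z ^+ i = 0) ->
  forall i, (i < n)%N -> f i = 0.
Proof.
move=> h i hi; have [rs [urs szrs rs1]] := unity_roots (leq_ltn_trans (leq0n i) hi).
pose q := \poly_(i < n) f i.
have q0 : q = 0.
  apply/eqP; apply: contraT => nz.
  have := @max_poly_roots _ q rs nz; rewrite szrs ltnNge size_poly; apply=> //.
  by apply/allP => z /rs1 /h hz; rewrite /root horner_poly hz.
by have := coef_poly n f i; rewrite -/q q0 coef0 hi.
Qed.

Section OneDimension.
Variables (n : nat) (z : C).
Hypothesis zn : z ^+ n = 1.

Lemma unity_sum_shift (f : int -> C) : (forall i, f (i + n%:Z) = f i) ->
  z * (\sum_(i < n) f (i%:Z + 1) * z ^+ i) = \sum_(i < n) f i%:Z * z ^+ i.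
Proof.
move=> per; rewrite mulr_sumr.
have -> : \sum_(i < n) z * (f (i%:Z + 1) * z ^+ i)
    = \sum_(i < n) f (i.+1)%:Z * z ^+ i.+1.
  by apply: eq_bigr => i _; rewrite mulrCA -exprS intS addrC.
(* Both sides become the sum over 0..n; its last term equals the added one by periodicity and
   [zn]. *)
apply: (addrI (f 0 * z ^+ 0)).
transitivity (\sum_(i < n.+1) f i%:Z * z ^+ i); first by rewrite big_ord_recl.
rewrite big_ord_recr /=.
by rewrite -[n%:Z]add0r per zn addrC expr0.
Qed.

Lemma unity_sum_diff (h : C) (f : int -> C) : z != 0 ->
  (forall i, f (i + n%:Z) = f i) ->
  \sum_(i < n) (f (i%:Z + 1) - 2 * f i%:Z + f (i%:Z - 1)) / h * z ^+ i
    = (z + z^-1 - 2) / h * \sum_(i < n) f i%:Z * z ^+ i.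
Proof.
move=> z0 per.
have up : \sum_(i < n) f (i%:Z + 1) * z ^+ i = z^-1 * \sum_(i < n) f i%:Z * z ^+ i.
  by rewrite -(unity_sum_shift per) mulKf.
have down : \sum_(i < n) f (i%:Z - 1) * z ^+ i = z * \sum_(i < n) f i%:Z * z ^+ i.
  rewrite -(@unity_sum_shift (fun i => f (i - 1))); last first.
    by move=> i; rewrite addrAC per.
  by congr (_ * _); apply: eq_bigr => i _; rewrite addrK.
transitivity ((\sum_(i < n) f (i%:Z + 1) * z ^+ i
    - 2 * \sum_(i < n) f i%:Z * z ^+ i
    + \sum_(i < n) f (i%:Z - 1) * z ^+ i) / h); last by rewrite up down; ring.
rewrite mulr_sumr -sumrB -big_split mulr_suml /=.
by apply: eq_bigr => i _; ring.
Qed.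

End OneDimension.

Section TwoDimensions.
Variables (n m : nat) (dx dy : C).
Hypotheses (n0 : (0 < n)%N) (m0 : (0 < m)%N).
Implicit Types (U : grid C) (e : stencil C).

Definition periodic U := (forall i j, U (i + n%:Z) j = U i j) /\
  (forall i j, U i (j + m%:Z) = U i j).

Lemma apply_periodic e U : periodic U -> periodic (apply_stencil dx dy e U).
Proof.
move=> [hx hy]; split; elim: e => //= [e IH|e IH|e IHe f IHf|e IHe f IHf|a e IH] i j.
- by rewrite /Xdiff -[i + n%:Z - 1]addrAC [i + n%:Z + 1]addrAC !IH.
- by rewrite /Ydiff !IH.
- by rewrite IHe IHf.
- by rewrite IHe IHf.
- by rewrite IH.
- by rewrite /Xdiff !IH.
- by rewrite /Ydiff -[j + m%:Z - 1]addrAC [j + m%:Z + 1]addrAC !IH.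
- by rewrite IHe IHf.
- by rewrite IHe IHf.
- by rewrite IH.
Qed.

Definition fourier U (z w : C) : C :=
  \sum_(i < n) (\sum_(j < m) U i%:Z j%:Z * w ^+ j) * z ^+ i.

Lemma fourierC U z w :
  fourier U z w = \sum_(j < m) (\sum_(i < n) U i%:Z j%:Z * z ^+ i) * w ^+ j.
Proof.
under eq_bigr do rewrite mulr_suml.
rewrite exchange_big; apply: eq_bigr => j _; rewrite mulr_suml.
by apply: eq_bigr => i _; rewrite mulrAC.
Qed.

Lemma fourier_eq0 U :
  (forall z w, z ^+ n = 1 -> w ^+ m = 1 -> fourier U z w = 0) ->
  forall i j, (i < n)%N -> (j < m)%N -> U i%:Z j%:Z = 0.
Proof.
move=> h i j hi hj; apply: (@unity_sum_eq0 m (fun j => U i%:Z j%:Z)) hj => w hw.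
apply: (@unity_sum_eq0 n (fun i => \sum_(j < m) U i%:Z j%:Z * w ^+ j)) hi => z hz.
exact: h.
Qed.

Section Modes.
Variables z w : C.
Hypotheses (zn : z ^+ n = 1) (wm : w ^+ m = 1).

Lemma unity_neq0 (k : nat) (x : C) : (0 < k)%N -> x ^+ k = 1 -> x != 0.
Proof.
move=> k0 xk; apply: contra_eqN xk => /eqP->.
by rewrite expr0n gtn_eqF // eq_sym oner_eq0.
Qed.

Lemma fourier_Xdiff U : periodic U ->
  fourier (Xdiff dx U) z w = (z + z^-1 - 2) / dx ^+ 2 * fourier U z w.
Proof.
move=> [per _]; pose f i := \sum_(j < m) U i j%:Z * w ^+ j.
rewrite -(unity_sum_diff zn _ (f := f)) ?(unity_neq0 n0) //; last first.
  by move=> i; apply: eq_bigr => j _; rewrite per.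
apply: eq_bigr => i _; congr (_ * _).
rewrite /f mulr_sumr -sumrB -big_split mulr_suml /=.
by apply: eq_bigr => j _; rewrite /Xdiff; ring.
Qed.

Lemma fourier_Ydiff U : periodic U ->
  fourier (Ydiff dy U) z w = (w + w^-1 - 2) / dy ^+ 2 * fourier U z w.
Proof.
move=> [_ per]; rewrite !fourierC; pose f j := \sum_(i < n) U i%:Z j * z ^+ i.
rewrite -(unity_sum_diff wm _ (f := f)) ?(unity_neq0 m0) //; last first.
  by move=> j; apply: eq_bigr => i _; rewrite per.
apply: eq_bigr => j _; congr (_ * _).
rewrite /f mulr_sumr -sumrB -big_split mulr_suml /=.
by apply: eq_bigr => i _; rewrite /Ydiff; ring.
Qed.

Lemma fourier_apply e U : periodic U ->
  fourier (apply_stencil dx dy e U) z w =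
  symbol ((z + z^-1 - 2) / dx ^+ 2) ((w + w^-1 - 2) / dy ^+ 2) e
    * fourier U z w.
Proof.
move=> per; elim: e => /= [|e IH|e IH|e IHe f IHf|e IHe f IHf|a e IH].
- by rewrite mul1r.
- by rewrite fourier_Xdiff ?IH ?mulrA //; apply: apply_periodic.
- by rewrite fourier_Ydiff ?IH ?mulrA //; apply: apply_periodic.
- rewrite mulrDl -IHe -IHf /fourier -big_split; apply: eq_bigr => i _ /=.
  rewrite -mulrDl -big_split; congr (_ * _); apply: eq_bigr => j _ /=.
  by rewrite mulrDl.
- rewrite mulrBl -IHe -IHf /fourier -sumrB; apply: eq_bigr => i _ /=.
  rewrite -mulrBl -sumrB; congr (_ * _); apply: eq_bigr => j _ /=.
  by rewrite mulrBl.
- rewrite -mulrA -IH /fourier mulr_sumr; apply: eq_bigr => i _.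
  rewrite mulrA mulr_sumr; congr (_ * _); apply: eq_bigr => j _.
  by rewrite mulrA.
Qed.

Lemma fourier_shiftx U : periodic U ->
  z * fourier (fun i j => U (i + 1) j) z w = fourier U z w.
Proof.
move=> [per _]; apply: (unity_sum_shift zn (f := fun i => \sum_(j < m) U i j%:Z * w ^+ j)).
by move=> i; apply: eq_bigr => j _; rewrite per.
Qed.

Lemma fourier_shifty U : periodic U ->
  w * fourier (fun i j => U i (j + 1)) z w = fourier U z w.
Proof.
move=> [_ per]; rewrite !fourierC.
apply: (unity_sum_shift wm (f := fun j => \sum_(i < n) U i%:Z j * z ^+ i)).
by move=> j; apply: eq_bigr => i _; rewrite per.
Qed.

Lemma fourierB U V :
  fourier (fun i j => U i j - V i j) z w = fourier U z w - fourier V z w.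
Proof.
rewrite /fourier -sumrB; apply: eq_bigr => i _.
rewrite -mulrBl -sumrB; congr (_ * _); apply: eq_bigr => j _.
by rewrite mulrBl.
Qed.

End Modes.

(** The difference of [U] and its shift has transform [z^-1 - 1] (or [w^-1 - 1]) times that of [U],
    which is zero at every frequency. *)
Lemma fourier_constant U : periodic U ->
  (forall z w, z ^+ n = 1 -> w ^+ m = 1 -> fourier U z w != 0 -> z = 1 /\ w = 1) ->
  forall i j, (i < n)%N -> (j < m)%N -> U i%:Z j%:Z = U 0 0.
Proof.
move=> per h.
have stepx i j : (i < n)%N -> (j < m)%N -> U (i%:Z + 1) j%:Z = U i%:Z j%:Z.
  move=> hi hj; apply/eqP; rewrite -subr_eq0; apply/eqP.
  apply: (@fourier_eq0 (fun i j => U (i + 1) j - U i j)) hi hj => z w hz hw.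
  rewrite fourierB -[X in _ - X](fourier_shiftx w hz per).
  have [U0|/(h _ _ hz hw)[-> _]] := eqVneq (fourier U z w) 0; last first.
    by rewrite mul1r subrr.
  rewrite (fourier_shiftx w hz per) U0 subr0; apply: (mulfI (unity_neq0 n0 hz)).
  by rewrite (fourier_shiftx w hz per) U0 mulr0.
have stepy i j : (i < n)%N -> (j < m)%N -> U i%:Z (j%:Z + 1) = U i%:Z j%:Z.
  move=> hi hj; apply/eqP; rewrite -subr_eq0; apply/eqP.
  apply: (@fourier_eq0 (fun i j => U i (j + 1) - U i j)) hi hj => z w hz hw.
  rewrite fourierB -[X in _ - X](fourier_shifty z hw per).
  have [U0|/(h _ _ hz hw)[_ ->]] := eqVneq (fourier U z w) 0; last first.
    by rewrite mul1r subrr.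
  rewrite (fourier_shifty z hw per) U0 subr0; apply: (mulfI (unity_neq0 m0 hw)).
  by rewrite (fourier_shifty z hw per) U0 mulr0.
elim=> [|i IH] j hi hj.
  elim: j hj => [//|j IH] hj; rewrite -IH ?(ltnW hj) // intS addrC stepy //.
  exact: ltnW.
by rewrite -(IH j (ltnW hi) hj) intS addrC stepx // ltnW.
Qed.

End TwoDimensions.
End Fourier.

(** * The amplification polynomial *)

(* -dt^2 times the symbol of the scheme, with r = c^2 dt^2 / dx^2,               *)
(* q = c^2 dt^2 / dy^2, X = - x / dx^2 and Y = - y / dy^2.                       *)
Definition growth (K : fieldType) (p : nat) (r q x y : K) : K :=
  match p with
  | 1%N => r * x + q * y
  | 2%N => r * (x + x ^+ 2 / 12) + q * (y + y ^+ 2 / 12)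
           - (r * x + q * y) ^+ 2 / 12
  | 3%N => r * (x + x ^+ 2 / 12 + x ^+ 3 / 90)
           + q * (y + y ^+ 2 / 12 + y ^+ 3 / 90)
           - (r ^+ 2 * (x ^+ 2 + x ^+ 3 / 6) + q ^+ 2 * (y ^+ 2 + y ^+ 3 / 6)
              + 2 * r * q * (x + x ^+ 2 / 12) * (y + y ^+ 2 / 12)) / 12
           + (r * x + q * y) ^+ 3 / 360
  | _ => 0
  end.

Section Growth.
Variable R : realFieldType.
Implicit Types (p : nat) (r q x y : R).

Lemma growthC p r q x y : growth p r q x y = growth p q r y x.
Proof. by case: p => [|[|[|[|p]]]] //=; ring. Qed.

Lemma growth_mono p r q x1 x2 y : (1 <= p <= 3)%N -> 0 < r -> 0 < q -> r + q < 1 ->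
  0 <= x1 -> x1 < x2 -> x2 <= 4 -> 0 <= y <= 4 ->
  growth p r q x1 y < growth p r q x2 y.
Proof.
move=> hp r0 q0 rq x10 x12 x24 /andP[y0 y4].
have rd : 0 < r * (x2 - x1) by rewrite mulr_gt0 // subr_gt0.
have x20 : 0 <= x2 by lra.
rewrite -subr_gt0; case: p hp => [|[|[|[|p]]]] //= _.
- by rewrite (_ : _ - _ = r * (x2 - x1)) //; ring.
  (* In the next two cases [D] is the divided difference in [x], divided by [r] *)
  (* and written as a combination of its values at (r, q) = (0, 0), (1, 0) and  *)
  (* (0, 1), plus the cubic terms.                                              *)
- pose D := (1 - r - q) * (1 + (x1 + x2) / 12) + r
            + q * ((1 - y / 6) + (x1 + x2) / 12).
  rewrite (_ : _ - _ = r * (x2 - x1) * D); last by rewrite /D; field.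
  apply: mulr_gt0 => //; rewrite /D.
  have h1 : 0 <= (1 - r - q) * (1 + (x1 + x2) / 12) by apply: mulr_ge0; lra.
  have h2 : 0 <= q * ((1 - y / 6) + (x1 + x2) / 12) by apply: mulr_ge0; lra.
  lra.
- pose s := x1 + x2; pose t := x1 ^+ 2 + x1 * x2 + x2 ^+ 2.
  pose v1 := r * x1 + q * y; pose v2 := r * x2 + q * y.
  pose D := (1 - r - q) * (1 + s / 12 + t / 90) + r * (1 - t / 360)
    + q * ((1 + s / 12) * (1 - (y + y ^+ 2 / 12) / 6) + t / 90)
    + (v1 ^+ 2 + v1 * v2 + v2 ^+ 2) / 360.
  rewrite (_ : _ - _ = r * (x2 - x1) * D); last by rewrite /D /v1 /v2 /s /t; field.
  have s0 : 0 <= s by rewrite /s; lra.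
  have t0 : 0 <= t by rewrite /t !addr_ge0 ?sqr_ge0 ?mulr_ge0.
  (* The bounds are the values at x1 = x2 = 4 and y = 4. Since 48 < 360 and 16/3 < 6, the factors in
     [h2] and [h3] have the right sign. *)
  have t48 : t <= 48 by rewrite /t; nra.
  have yb : y + y ^+ 2 / 12 <= 16 / 3 by nra.
  have v10 : 0 <= v1 by rewrite /v1 addr_ge0 // mulr_ge0 // ltW.
  have v20 : 0 <= v2 by rewrite /v2 addr_ge0 // mulr_ge0 // ltW.
  apply: mulr_gt0 => //; rewrite /D.
  have h1 : 0 <= (1 - r - q) * (1 + s / 12 + t / 90) by apply: mulr_ge0; lra.
  have h2 : 0 < r * (1 - t / 360) by apply: mulr_gt0; lra.
  have h3 : 0 <= (1 + s / 12) * (1 - (y + y ^+ 2 / 12) / 6) by apply: mulr_ge0; lra.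
  have h4 : 0 <= q * ((1 + s / 12) * (1 - (y + y ^+ 2 / 12) / 6) + t / 90).
    by apply: mulr_ge0; lra.
  have h5 : 0 <= v1 ^+ 2 + v1 * v2 + v2 ^+ 2.
    by rewrite !addr_ge0 ?sqr_ge0 ?mulr_ge0.
  lra.
Qed.

(** The gap to 4 is explicit in r + q, apart from a positive multiple of r q for p = 3. For p = 1
    and p = 2 it closes exactly at r + q = 1. *)
Lemma growth_max p r q : (1 <= p <= 3)%N -> 0 < r -> 0 < q -> r + q < 1 ->
  growth p r q 4 4 < 4.
Proof.
move=> hp r0 q0 rq; rewrite -subr_gt0; case: p hp => [|[|[|[|p]]]] //= _.
- lra.
- rewrite (_ : _ - _ = 4 / 3 * ((1 - (r + q)) * (3 - (r + q)))); last by field.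
  by rewrite !mulr_gt0 //; lra.
- pose s := r + q.
  rewrite (_ : _ - _ = (1 - s) * (180 - 92 * s + 8 * s ^+ 2) / 45 + 8 / 27 * (r * q));
    last by rewrite /s; field.
  have s2 : 0 <= s ^+ 2 by apply: sqr_ge0.
  by rewrite addr_gt0 ?mulr_gt0 //; rewrite /s in s2 *; lra.
Qed.

(** Monotonicity compares the value with those at (0, 0) and (4, 4); strictness at the lower end
    comes from the nonzero coordinate. *)
Lemma growth_bound p r q x y : (1 <= p <= 3)%N -> 0 < r -> 0 < q -> r + q < 1 ->
  0 <= x <= 4 -> 0 <= y <= 4 -> (x != 0) || (y != 0) ->
  0 < growth p r q x y < 4.
Proof.
move=> hp r0 q0 rq /andP[x0 x4] /andP[y0 y4] nz.
have mx x1 x2 y' : 0 <= x1 -> x1 <= x2 -> x2 <= 4 -> 0 <= y' <= 4 ->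
    growth p r q x1 y' <= growth p r q x2 y'.
  move=> h1; rewrite le_eqVlt => /orP[/eqP->//|h2] h3 h4.
  exact/ltW/growth_mono.
have my x' y1 y2 : 0 <= y1 -> y1 <= y2 -> y2 <= 4 -> 0 <= x' <= 4 ->
    growth p r q x' y1 <= growth p r q x' y2.
  move=> h1; rewrite le_eqVlt => /orP[/eqP->//|h2] h3 h4.
  by rewrite ![growth p r q x' _]growthC; apply/ltW/growth_mono; rewrite // addrC.
have g0 : growth p r q 0 0 = 0.
  by case: (p) => [|[|[|[|?]]]] //=; field.
apply/andP; split; last first.
  apply: le_lt_trans (growth_max hp r0 q0 rq).
  apply: le_trans (mx _ _ _ x0 x4 (lexx _) _) _; first by rewrite y0.
  by apply: my => //; lra.
rewrite -g0; case/orP: nz => nz.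
  apply: (@le_lt_trans _ _ (growth p r q 0 y)); first by apply: my; rewrite ?lexx //; lra.
  by apply: growth_mono => //; rewrite ?y0 // lt0r nz.
apply: (@lt_le_trans _ _ (growth p r q 0 y)); last by apply: mx; rewrite ?y0.
rewrite ![growth p r q 0 _]growthC; apply: growth_mono => //; rewrite ?lexx //.
- by rewrite addrC.
- by rewrite lt0r nz.
- by lra.
Qed.

End Growth.

Lemma me_symbolE (K : numFieldType) (c dx dy dt x y : K) (p : nat) :
  (1 <= p <= 3)%N -> dx != 0 -> dy != 0 ->
  dt ^+ 2 * symbol (- x / dx ^+ 2) (- y / dy ^+ 2) (me_stencil dx dy c dt p)
    = - growth p (c ^+ 2 * dt ^+ 2 / dx ^+ 2) (c ^+ 2 * dt ^+ 2 / dy ^+ 2) x y.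
Proof.
by case: p => [|[|[|[|p]]]] //= _ dx0 dy0; field; rewrite ?dx0 ?dy0.
Qed.

Lemma growth_morph (K L : numFieldType) (f : {rmorphism K -> L}) p r q x y :
  growth p (f r) (f q) (f x) (f y) = f (growth p r q x y).
Proof.
by case: p => [|[|[|[|p]]]] /=; field.
Qed.

(** * From Fourier modes to stability *)

Section Stability.
Variable R : realType.
Local Open Scope complex_scope.

(** A root of unity has modulus 1, so its inverse is its conjugate and x = 2 - 2 Re z works; x = 0
    means Re z = 1, which leaves no imaginary part. *)
Lemma unit_circle (n : nat) (z : R[i]) : (0 < n)%N -> z ^+ n = 1 ->
  exists x : R, [/\ 0 <= x <= 4, z + z^-1 - 2 = - x%:C & x = 0 -> z = 1].
Proof.
case: z => a b n0 zn.
have ab : a ^+ 2 + b ^+ 2 = 1.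
  have := congr1 Num.norm zn; rewrite normrX normr1 => /eqP.
  rewrite pexpr_eq1 // normc_def /= => /eqP [h].
  by rewrite -[LHS]sqr_sqrtr ?addr_ge0 ?sqr_ge0 // h expr1n.
have zV : (a +i* b)^-1 = a -i* b.
  have z0 : a +i* b != 0 by exact: unity_neq0 n0 zn.
  apply: (mulfI z0); rewrite divff //; apply/eqP; rewrite eq_complex /=.
  by apply/andP; split; apply/eqP; rewrite -?ab; ring.
have a2 : -1 <= a <= 1 by apply/andP; split; nra.
exists (2 - 2 * a); split.
- by lra.
- rewrite zV; apply/eqP; rewrite eq_complex /=.
  by apply/andP; split; apply/eqP; ring.
- move=> h; have a1 : a = 1 by lra.
  have /eqP : b ^+ 2 = 0 by move: ab; rewrite a1; lra.
  by rewrite sqrf_eq0 a1 => /eqP->.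
Qed.

Lemma lcbc_stable (p : nat) (bcs : boundary) (c dx dy dt : R) (Nx Ny : nat) :
  (1 <= p <= 3)%N -> 0 < c -> 0 < dx -> 0 < dy -> 0 < dt ->
  (p <= Nx)%N -> (p <= Ny)%N ->
  c ^+ 2 * dt ^+ 2 / dx ^+ 2 + c ^+ 2 * dt ^+ 2 / dy ^+ 2 < 1 ->
  stable p bcs c dx dy dt Nx Ny.
Proof.
move=> hp c_gt0 dx_gt0 dy_gt0 dt_gt0 pNx pNy cfl A phi [nz bc scheme].
have p0 : (0 < p)%N by case/andP: hp.
have c0 : c%:C != 0 by rewrite fmorph_eq0 gt_eqF.
have dt0 : dt%:C != 0 by rewrite fmorph_eq0 gt_eqF.
have dx0 : 0 < dx%:C by rewrite ltcR.
have dy0 : 0 < dy%:C by rewrite ltcR.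
have n0 : (0 < 4 * Nx)%N by lia.
have m0 : (0 < 4 * Ny)%N by lia.
pose M := me_stencil dx%:C dy%:C c%:C dt%:C p.
have scheme0 i j : on_grid Nx Ny i j -> ~~ on_dirichlet bcs Nx Ny i j ->
    (A ^+ 2 - 2 * A + 1) * phi i j
      = dt%:C ^+ 2 * A * apply_stencil dx%:C dy%:C M phi i j.
  move=> hg hd; have := scheme 0%N i j hg hd.
  rewrite me_stencilE // apply_scale -/M expr1 expr0 mul1r => /(canRL (mulfVK _)).
  rewrite expf_neq0 // => /(_ isT) h.
  transitivity (A ^+ 2 * phi i j - 2 * (A * phi i j) + phi i j); first by ring.
  by rewrite h; ring.
(* For A = 0, [scheme0] would make [phi] vanish off the Dirichlet points, and it vanishes on them
   anyway. *)
have A0 : A != 0.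
  apply/eqP => A0; have [i [j [hg]]] := nz; case/eqP.
  have [hd|hd] := boolP (on_dirichlet bcs Nx Ny i j).
    by case: bc => /(_ i j hd).
  by have := scheme0 i j hg hd; rewrite A0 => h; rewrite -[LHS]mul1r; ring: h.
pose lam := (A ^+ 2 - 2 * A + 1) / (dt%:C ^+ 2 * A).
have lamE : dt%:C ^+ 2 * lam * A = A ^+ 2 - 2 * A + 1.
  by rewrite /lam; field; rewrite A0.
have eig i j : on_grid Nx Ny i j -> ~~ on_dirichlet bcs Nx Ny i j ->
    apply_stencil dx%:C dy%:C M phi i j = lam * phi i j.
  move=> hg hd; have h := scheme0 i j hg hd.
  rewrite /lam mulrAC h mulrAC divff ?mul1r //.
  by rewrite mulf_neq0 ?expf_neq0.
have [wx wy] := me_stencil_width dx%:C dy%:C c%:C dt%:C p.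
pose psi := extension Nx Ny bcs phi.
have psi_eig : apply_stencil dx%:C dy%:C M psi =2 fun i j => lam * psi i j.
  exact: (extension_eigen c0 dx0 dy0 p0 pNx pNy bc wx wy eig).
have psi_grid i j : 0 <= i <= Nx%:Z -> 0 <= j <= Ny%:Z -> psi i j = phi i j.
  exact: (extension_grid bcs phi p0 pNx pNy).
have psi_per : periodic (4 * Nx) (4 * Ny) psi.
  split.
    apply: (reflectx_periodic (bsign2 _ _) (bsign2 _ _)).
      exact: (extension_left c0 dx0 dy0 p0 pNx pNy bc).
    exact: (extension_right c0 dx0 dy0 p0 pNx pNy bc).
  apply: (reflecty_periodic (bsign2 _ _) (bsign2 _ _)).
    exact: (extension_bottom c0 dx0 dy0 p0 pNx pNy bc).
  exact: (extension_top c0 dx0 dy0 p0 pNx pNy bc).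
pose r := c ^+ 2 * dt ^+ 2 / dx ^+ 2; pose q := c ^+ 2 * dt ^+ 2 / dy ^+ 2.
have r0 : 0 < r by rewrite !(divr_gt0, mulr_gt0, exprn_gt0).
have q0 : 0 < q by rewrite !(divr_gt0, mulr_gt0, exprn_gt0).
have mode z w : z ^+ (4 * Nx) = 1 -> w ^+ (4 * Ny) = 1 ->
    fourier (4 * Nx) (4 * Ny) psi z w != 0 ->
    exists g : R, dt%:C ^+ 2 * lam = - g%:C /\
      (0 < g < 4 \/ [/\ g = 0, z = 1 & w = 1]).
  move=> hz hw F0.
  have [x [x4 zx x1]] := unit_circle n0 hz.
  have [y [y4 wy' y1]] := unit_circle m0 hw.
  have lamS : lam = symbol (- x%:C / dx%:C ^+ 2) (- y%:C / dy%:C ^+ 2) M.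
    apply: (mulIf F0); rewrite -zx -wy' -(fourier_apply dx%:C dy%:C n0 m0 hz hw M psi_per) //.
    rewrite /fourier mulr_sumr; apply: eq_bigr => i _.
    rewrite mulrA mulr_sumr; congr (_ * _); apply: eq_bigr => j _.
    by rewrite psi_eig mulrA.
  exists (growth p r q x y); split.
    rewrite lamS me_symbolE ?(gt_eqF dx0) ?(gt_eqF dy0) // -growth_morph.
    by rewrite /r /q !(rmorphM, fmorphV, rmorphXn).
  have [|] := boolP ((x != 0) || (y != 0)).
    by left; apply: growth_bound.
  rewrite negb_or !negbK => /andP[/eqP ex /eqP ey]; right.
  by rewrite x1 // y1 // ex ey; split=> //; case: (p) => [|[|[|[|?]]]] //=; field.
have [i0 [j0 [/andP[hi0 hj0] nz0]]] := nz.
(* Some frequency must occur, by injectivity of the transform, because [phi] is nonzero at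
   [(i0, j0)]. *)
have [[z [w [hz hw F0]]]|noF] := boolp.pselect (exists z w,
    [/\ z ^+ (4 * Nx) = 1, w ^+ (4 * Ny) = 1
      & fourier (4 * Nx) (4 * Ny) psi z w != 0]); last first.
  case/eqP: nz0; rewrite -psi_grid //.
  case: i0 hi0 => // i0 hi0; case: j0 hj0 => // j0 hj0.
  apply: (@fourier_eq0 _ (4 * Nx) (4 * Ny) psi);
    [|by move: hi0 n0; clear; lia|by move: hj0 m0; clear; lia].
  by move=> z w hz hw; apply/eqP; apply: contra_notT noF => F0; exists z, w.
have [g [lamg gcase]] := mode z w hz hw F0.
exists (1 - g / 2); split.
  have -> : A ^+ 2 - 2 * (1 - g / 2)%:C * A + 1
      = A ^+ 2 - 2 * A + 1 + g%:C * A by field.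
  by rewrite -lamE lamg; ring.
case: gcase => [g4|[g0 z1 w1]].
  by left; rewrite ltr_norml; lra.
right; split; last by rewrite g0 mul0r subr0.
(* All occurring frequencies share [lam], hence the same g = 0, so each of them is z = w = 1. *)
have psi_const i j : (i < 4 * Nx)%N -> (j < 4 * Ny)%N -> psi i%:Z j%:Z = psi 0 0.
  apply: (fourier_constant n0 m0 psi_per) => z' w' hz' hw' F0'.
  have [g' [lamg' [g4|[]//]]] := mode z' w' hz' hw' F0'.
  move: lamg'; rewrite lamg g0 => /oppr_inj/complexI g'0.
  by rewrite -g'0 ltxx in g4.
have phi_const i j : on_grid Nx Ny i j -> phi i j = psi 0 0.
  move=> /andP[hi hj]; rewrite -psi_grid //.
  case: i hi => // i hi; case: j hj => // j hj.
  apply: psi_const.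
    by move: hi n0; clear; lia.
  by move: hj m0; clear; lia.
split; last by exists (psi 0 0).
have a0 : psi 0 0 != 0 by rewrite -(phi_const i0 j0) // /on_grid hi0.
(* A nonzero constant cannot vanish on a Dirichlet face. The corners (0, 0) and (Nx, Ny) together
   touch all four faces, so every face is Neumann. *)
have nd i j : on_grid Nx Ny i j -> ~~ on_dirichlet bcs Nx Ny i j.
  move=> hg; apply/negP => hd; case/eqP: a0.
  by rewrite -(phi_const i j hg); case: bc => /(_ i j hd).
have o00 : on_grid Nx Ny 0 0 by rewrite /on_grid; clear; lia.
have oNN : on_grid Nx Ny Nx%:Z Ny%:Z by rewrite /on_grid; clear; lia.
have := nd _ _ o00; have := nd _ _ oNN.
rewrite /on_dirichlet o00 oNN !eqxx /=.
by case: (bc_left bcs); case: (bc_right bcs); case: (bc_bottom bcs);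
  case: (bc_top bcs); rewrite //= ?orbT.
Qed.

End Stability.

Theorem theorem5 (R : realType) (p : nat) (bcs : boundary)
    (c Lx Ly dt : R) (Nx Ny : nat)
    (hp : (1 <= p <= 3)%N) (hc : 0 < c) (hLx : 0 < Lx) (hLy : 0 < Ly)
    (hdt : 0 < dt) (hNx : (p <= Nx)%N) (hNy : (p <= Ny)%N) :
  let dx := Lx / Nx%:R in
  let dy := Ly / Ny%:R in
  c ^+ 2 * dt ^+ 2 * (1 / dx ^+ 2 + 1 / dy ^+ 2) < 1 ->
  stable p bcs c dx dy dt Nx Ny.
Proof.
move=> dx dy cfl.
have p0 : (0 < p)%N by case/andP: hp.
have dx0 : 0 < dx by rewrite divr_gt0 // ltr0n (leq_trans p0).
have dy0 : 0 < dy by rewrite divr_gt0 // ltr0n (leq_trans p0).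
by apply: lcbc_stable => //; move: cfl; rewrite mulrDr !mulrA !mulr1.
Qed.
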